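(* Every (finite-dimensional) ANR having the $\delta$-fractured maps property ($\delta$-FMP) satisfies the disjoint homotopies property (DHP).
   Context: All spaces are finite-dimensional. ANRs are locally contractible, locally compact, separable metric spaces. Both $D$ and $I$ denote $[0,1]$; $p:D\times I\to I$ is the natural projection. Maps are continuous; approximations are in the sup metric. A path homotopy is a map $f:D\times I\to X$, with $f_t(x)=f(x,t)$; it is a constant homotopy if $f(x,t)=f(x,0)$ for all $x,t$. $\delta$-fractured (modified definition): a map $f:D\times I\to X$ is $\delta$-fractured over a map $g:D\times I\to X$ if there are pairwise disjoint balls (closed 2-cells) $B_1,\dots,B_m$ in $D\times I$ such that (1) $\mathrm{diam}(B_i)<\delta$ for each $i$; (2) $f^{-1}(\mathrm{im}(g))\subset\bigcup_{i=1}^m \mathrm{int}(B_i)$; and (3) $p(g^{-1}(f(B_i)))\neq I$ for each $i$. $\delta$-FMP: $X$ has the $\delta$-fractured maps property if for every path homotopy $f:D\times I\to X$, constant homotopy $g:D\times I\to X$, and $\delta>0$, there are arbitrarily close approximations $f'$ of $f$ and $g'$ of $g$ such that $f'$ is $\delta$-fractured over $g'$. DHP: $X$ has the disjoint homotopies property if any two path homotopies $f,g:D\times I\to X$ can be approximated arbitrarily closely by homotopies $f',g':D\times I\to X$ such that $f'_t(D)\cap g'_t(D)=\emptyset$ for all $t\in I$. *)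

(* Defs.v *)
From mathcomp Require Import all_boot all_order all_algebra.
From mathcomp Require Import all_classical all_reals all_analysis.

Set Implicit Arguments.
Unset Strict Implicit.
Unset Printing Implicit Defensive.

Import Order.TTheory GRing.Theory Num.Theory.
Import numFieldNormedType.Exports.

Local Open Scope classical_set_scope.
Local Open Scope ring_scope.

Section Spaces.
Context {R : realType}.

(** Lebesgue covering dimension; for metrizable spaces, arbitrary open covers
    and finite open covers give the same notion. *)
Definition covering_dim_le (X : topologicalType) (n : nat) :=
  forall U : set (set X), U `<=` open -> \bigcup_(A in U) A = setT ->
  exists V : set (set X),
    [/\ V `<=` open,
        \bigcup_(A in V) A = setT,
        forall A, V A -> exists2 B, U B & A `<=` B &
        forall x, ([set A | V A /\ A x] #<= `I_n.+1)%card].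

Definition finite_dimensional (X : topologicalType) :=
  exists n, covering_dim_le X n.

(** Every neighbourhood [U] of [x] contains a neighbourhood [V] of [x] whose
    inclusion into [U] is null-homotopic in [U]. *)
Definition locally_contractible (X : topologicalType) :=
  forall (x : X) (U : set X), nbhs x U ->
  exists2 V : set X, nbhs x V /\ V `<=` U &
  exists (H : X * R -> X) (y : X),
    [/\ {within V `*` `[0, 1], continuous H},
        forall v, V v -> H (v, 0) = v,
        forall v, V v -> H (v, 1) = y &
        forall v t, V v -> t \in `[0, 1] -> U (H (v, t))].

Definition separable (X : topologicalType) :=
  exists2 S : set X, countable S & dense S.

(** For finite-dimensional [X] this agrees with the extension-theoretic
    definition of an absolute neighbourhood retract. *)
Definition ANR (X : metricType R) :=
  [/\ locally_contractible X, locally_compact [set: X] & separable X].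

End Spaces.

Section Homotopies.
Context {R : realType}.

(** [D x I]: the first coordinate is the path parameter, the second is the
    time, so the projection [p : D x I -> I] is [snd]. A map on [D x I] is a
    total function on [R * R] of which only the restriction to [square]
    matters. *)
Definition square : set (R * R) := `[0, 1] `*` `[0, 1].

Definition eucl_dist (z w : R * R) : R :=
  Num.sqrt ((z.1 - w.1) ^+ 2 + (z.2 - w.2) ^+ 2).

Definition diam (B : set (R * R)) : R :=
  sup [set eucl_dist z w | z in B & w in B].

Definition disk : set (R * R) := [set z | z.1 ^+ 2 + z.2 ^+ 2 <= 1].
Definition open_disk : set (R * R) := [set z | z.1 ^+ 2 + z.2 ^+ 2 < 1].

Definition homeomorphism_on (T U : topologicalType) (A : set T) (B : set U)
    (h : T -> U) :=
  [/\ set_bij A B h,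
      {within A, continuous h} &
      exists2 k : U -> T, {within B, continuous k} & {in A, cancel h k}].

Variable X : metricType R.
Implicit Types f g : R * R -> X.

Definition path_homotopy f := {within square, continuous f}.

Definition constant_homotopy f :=
  path_homotopy f /\ forall x t, square (x, t) -> f (x, t) = f (x, 0).

Definition approximates (eps : R) f f' :=
  forall z, square z -> mdist (f z) (f' z) < eps.

(** The balls are the closed 2-cells [B i], parametrized by the closed disk
    through [h i]; [int (B i)] is the interior of the cell, that is the cell
    minus its boundary circle. *)
Definition fractured (delta : R) f g :=
  exists (m : nat) (B : 'I_m -> set (R * R)) (h : 'I_m -> R * R -> R * R),
    [/\ forall i, B i `<=` square /\ homeomorphism_on disk (B i) (h i),
        forall i j, i <> j -> B i `&` B j = set0,
        forall i, diam (B i) < delta,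
        square `&` f @^-1` (g @` square) `<=` \bigcup_i (h i @` open_disk) &
        forall i, snd @` (square `&` g @^-1` (f @` B i)) <> `[0, 1]%classic].

Definition delta_FMP :=
  forall f g (delta : R),
    path_homotopy f -> constant_homotopy g -> 0 < delta ->
  forall eps : R, 0 < eps ->
  exists f' g',
    [/\ path_homotopy f', path_homotopy g',
        approximates eps f f', approximates eps g g' &
        fractured delta f' g'].

Definition DHP :=
  forall f g, path_homotopy f -> path_homotopy g ->
  forall eps : R, 0 < eps ->
  exists f' g',
    [/\ path_homotopy f', path_homotopy g',
        approximates eps f f', approximates eps g g' &
        forall t : R, t \in `[0, 1] ->
          (fun x => f' (x, t)) @` `[0, 1] `&` (fun x => g' (x, t)) @` `[0, 1]
          = set0].

End Homotopies.

(* Main.v *)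
(** First let [g] be constant. For [delta] small, the fractured maps property
    gives [f'], [g'] such that [f'^-1 (im g')] lies in the interiors of small
    disjoint cells [B_i], and a time [T_i] such that [g'_(T_i)] misses
    [f' (B_i)]. By invariance of domain in the plane the interior of each cell
    is open, so a self-map of the square that is the identity off the cells and
    expands a tiny neighbourhood of a point over most of each [B_i] is
    continuous; precomposing [f'] with it, we may assume that
    [f'^-1 (im g')] meets the [B_i] at pairwise distinct times [s_i]. Now
    reparametrize the time of [g'] (almost constant, hence still close to [g])
    so that it equals [T_i] near [s_i]: the homotopies become disjoint.

    For arbitrary [f] and [g], cut the time interval into short pieces. On each
    piece, move first a path near [f_t] while the path near [g_t] is almost
    still, then conversely. Local contractibility provides the short homotopies
    between nearby paths, both to define these moves and to glue them; paths at
    a positive distance from each other remain disjoint along such homotopies. *)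

Require Import Defs.
From mathcomp Require Import all_boot all_order all_algebra.
From mathcomp Require Import all_classical all_reals all_analysis.
From mathcomp Require Import ring lra.

Set Implicit Arguments.
Unset Strict Implicit.
Unset Printing Implicit Defensive.

Import Order.TTheory GRing.Theory Num.Theory.
Import numFieldNormedType.Exports.

Local Open Scope classical_set_scope.
Local Open Scope ring_scope.

(** * Continuity on subsets *)

Section Continuity.
Context {R : realType}.

(** The cells may occupy overlapping time intervals and ask for different times T_i, whereas a
    reparametrization of g' takes one value at each instant; this conflict is what the collapse to
    distinct heights resolves. The reparametrization runs through widely separated times T_i, so it
    is harmless only for a constant g, and this is why the general case moves one path at a time.

    The fractured maps property returns approximations, so the endpoints of a move are never
    prescribed. Two precautions deal with this. The fineness of a connecting homotopy is chosen
    after the distance between the two disjoint paths is known. And each block aims afresh at the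
    slices of f and g at its final time: it starts within [sg] of f and g and ends within the same
    [sg], so errors do not add up over the blocks.

    Invariance of domain rests on a parity argument: a loop with F(s + 1/2) = - F(s) turns an odd
    number of times around the origin, so it cannot be contracted away from the origin. Angles are
    sums of arctangents along a fine sampling of the loop. *)

Lemma within_comp (S T U : topologicalType) (A : set S) (B : set T)
    (f : S -> T) (g : T -> U) :
  {within B, continuous g} -> {within A, continuous f} ->
  (forall x, A x -> B (f x)) -> {within A, continuous (fun x => g (f x))}.
Proof.
move=> /subspace_continuousP cg /subspace_continuousP cf AB.
apply/subspace_continuousP => x Ax.
apply: (@cvg_comp _ _ _ f g _ (within B (nbhs (f x)))); last exact/cg/AB.
move=> W WB.
have fW : \forall y \near x, A y -> B (f y) -> W (f y) by exact: cf Ax _ WB.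
have : \forall y \near x, A y -> W (f y).
  by apply: filterS fW => y h Ay; apply: h => //; exact: AB.
by [].
Qed.

Lemma within_ext (S T : topologicalType) (A : set S) (f g : S -> T) :
  (forall x, A x -> f x = g x) ->
  {within A, continuous f} -> {within A, continuous g}.
Proof.
by move=> fg; apply: subspace_eq_continuous => x; rewrite inE; exact: fg.
Qed.

Lemma within_pair (S T U : topologicalType) (A : set S) (f : S -> T) (g : S -> U) :
  {within A, continuous f} -> {within A, continuous g} ->
  {within A, continuous (fun x => (f x, g x))}.
Proof. by move=> cf cg x; apply: cvg_pair; [exact: cf|exact: cg]. Qed.

Lemma within_fst (S : topologicalType) (A : set S) (f : S -> R * R) :
  {within A, continuous f} -> {within A, continuous (fun x => (f x).1)}.
Proof. by move=> cf x; apply: cvg_comp (cf x) _; exact: cvg_fst. Qed.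

Lemma within_snd (S : topologicalType) (A : set S) (f : S -> R * R) :
  {within A, continuous f} -> {within A, continuous (fun x => (f x).2)}.
Proof. by move=> cf x; apply: cvg_comp (cf x) _; exact: cvg_snd. Qed.

Lemma within_add (S : topologicalType) (A : set S) (f g : S -> R) :
  {within A, continuous f} -> {within A, continuous g} ->
  {within A, continuous (fun x => f x + g x)}.
Proof. by move=> cf cg x; apply: cvgD; [exact: cf|exact: cg]. Qed.

Lemma within_opp (S : topologicalType) (A : set S) (f : S -> R) :
  {within A, continuous f} -> {within A, continuous (fun x => - f x)}.
Proof. by move=> cf x; apply: cvgN; exact: cf. Qed.

Lemma within_mul (S : topologicalType) (A : set S) (f g : S -> R) :
  {within A, continuous f} -> {within A, continuous g} ->
  {within A, continuous (fun x => f x * g x)}.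
Proof. by move=> cf cg x; apply: cvgM; [exact: cf|exact: cg]. Qed.

Lemma within_inv (S : topologicalType) (A : set S) (f : S -> R) :
  (forall x, A x -> f x != 0) ->
  {within A, continuous f} -> {within A, continuous (fun x => (f x)^-1)}.
Proof.
move=> f0 /subspace_continuousP cf; apply/subspace_continuousP => x Ax.
by apply: cvgV; [exact: f0|exact: cf].
Qed.

Lemma within_cst (S T : topologicalType) (A : set S) (c : T) :
  {within A, continuous (fun=> c)}.
Proof. by apply: continuous_subspaceT => x; exact: cvg_cst. Qed.

Lemma within_id (S : topologicalType) (A : set S) :
  {within A, continuous (fun x : S => x)}.
Proof. by apply: continuous_subspaceT => x; exact: cvg_id. Qed.

Lemma within_cont (S T U : topologicalType) (A : set S) (f : S -> T) (g : T -> U) :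
  continuous g -> {within A, continuous f} ->
  {within A, continuous (fun x => g (f x))}.
Proof. by move=> cg cf x; apply: cvg_comp (cf x) _; exact: cg. Qed.

Lemma within_norm (S : topologicalType) (A : set S) (f : S -> R) :
  {within A, continuous f} -> {within A, continuous (fun x => `|f x|)}.
Proof. by move=> cf x; apply: cvg_norm; exact: cf. Qed.

Lemma within_max (S : topologicalType) (A : set S) (f g : S -> R) :
  {within A, continuous f} -> {within A, continuous g} ->
  {within A, continuous (fun x => Num.max (f x) (g x))}.
Proof.
move=> cf cg; have E x : Num.max (f x) (g x) = (f x + g x + `|f x - g x|) * 2^-1.
  by rewrite maxr_absE.
under eq_fun do rewrite E.
apply: within_mul; last exact: within_cst.
apply: within_add; first exact: within_add.
by apply: within_norm; apply: within_add => //; exact: within_opp.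
Qed.

Lemma within_min (S : topologicalType) (A : set S) (f g : S -> R) :
  {within A, continuous f} -> {within A, continuous g} ->
  {within A, continuous (fun x => Num.min (f x) (g x))}.
Proof.
move=> cf cg; have E x : Num.min (f x) (g x) = - Num.max (- f x) (- g x).
  by rewrite oppr_max !opprK.
under eq_fun do rewrite E.
by apply: within_opp; apply: within_max; exact: within_opp.
Qed.

Lemma within_sqrt (S : topologicalType) (A : set S) (f : S -> R) :
  {within A, continuous f} -> {within A, continuous (fun x => Num.sqrt (f x))}.
Proof. by move=> cf; apply: within_cont => //; exact: sqrt_continuous. Qed.

(** The test [P] may succeed on part of [B], as a large inequality does; such points are then
    required to lie in [A], hence in the overlap, where the two maps agree. *)
Lemma within_glue (S T : topologicalType) (A B : set S) (f g : S -> T)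
    (P : S -> bool) :
  closed A -> closed B -> (forall x, A x -> P x) ->
  (forall x, A x -> B x -> f x = g x) -> (forall x, B x -> P x -> A x) ->
  {within A, continuous f} -> {within B, continuous g} ->
  {within A `|` B, continuous (fun x => if P x then f x else g x)}.
Proof.
move=> cA cB AP fg BPA cf cg; apply: withinU_continuous => //.
- by apply: within_ext cf => x Ax; rewrite AP.
- by apply: within_ext cg => x Bx; case: ifPn => // Px; rewrite fg//; exact: BPA.
Qed.

Lemma within_bigcup_closed (S T : topologicalType) n (A : 'I_n -> set S) (f : S -> T) :
  (forall i, closed (A i)) -> (forall i, {within A i, continuous f}) ->
  {within \bigcup_i A i, continuous f}.
Proof.
move=> cA cf; apply/subspace_continuousP => x [i0 _ Ax0] W /= nW.
have H i : \forall y \near x, A i y -> W (f y).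
  have [Ai|nAi] := pselect (A i x).
    by have /subspace_continuousP := cf i; move/(_ x Ai _ nW).
  have : nbhs x (~` A i) by apply: open_nbhs_nbhs; split => //; exact: closed_openC.
  by apply: filterS => y.
have HI : \forall y \near x, forall i, A i y -> W (f y) by exact: filter_forall.
have : \forall y \near x, (\bigcup_i A i) y -> W (f y).
  by apply: filterS HI => y Hy [i _ Ai]; exact: (Hy i).
by [].
Qed.

(** Heine-Cantor on a compact subset: half of a radius of continuity at x is spent on a nearby
    centre x', the other half on the distance from x' to y. *)
Lemma within_compact_unif (S : pseudoMetricType R) (T : pseudoMetricType R)
    (A : set S) (f : S -> T) (eps : R) :
  compact A -> {within A, continuous f} -> 0 < eps ->
  exists2 d : R, 0 < d & forall x y, A x -> A y -> ball x d y -> ball (f x) eps (f y).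
Proof.
move=> /compact_near_coveringP/near_covering_withinP cA /subspace_continuousP cf e0.
have Hc : forall x, A x -> \forall x' \near x & d \near 0^'+, A x' ->
    forall y, A y -> ball x' d y -> ball (f x') eps (f y).
  move=> x Ax.
  have : \forall y \near x, A y -> ball (f x) (eps / 2) (f y).
    by apply: cf Ax _ _; apply: nbhsx_ballx; rewrite divr_gt0.
  move=> /nbhs_ballP[r /= r0 Hr].
  exists (ball x (r / 2), [set d | d < r / 2]) => /=.
    split; first by apply: nbhsx_ballx; rewrite divr_gt0.
    by apply: nbhs_right_lt; rewrite divr_gt0.
  move=> [x' d] /= [xx' dr] Ax' y Ay x'y.
  have xx'r : ball x r x' by apply: le_ball xx'; rewrite ler_pdivrMr// ler_pMr// ler1n.
  have xyr : ball x r y by rewrite [r]splitr; apply: ball_triangle xx' _; apply: le_ball x'y; exact: ltW.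
  rewrite [eps]splitr; apply: ball_triangle (Hr _ xyr Ay).
  by apply: ball_sym; exact: Hr.
have Hn := cA _ _ _ (@at_right_proper_filter R 0) Hc.
near (0:R)^'+ => d.
exists d; first by near: d; exact: nbhs_right_gt.
by move=> x y Ax Ay; apply: (near Hn d) => //.
Unshelve. all: by end_near. Qed.

Lemma square_compact : compact (square : set (R * R)).
Proof. by apply: compact_setX; exact: segment_compact. Qed.

End Continuity.

(** * Angles and planar loops *)

Section Winding.
Context {R : realType}.
Implicit Types z w : R * R.

(** With the plane seen as the complex numbers, [dotp z w] and [cross z w] are the real and
    imaginary parts of conj(z) w. *)
Definition dotp z w := z.1 * w.1 + z.2 * w.2.
Definition cross z w := z.1 * w.2 - z.2 * w.1.

(** The oriented angle from [z] to [w], correct when [0 < dotp z w]. *)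
Definition angle z w := atan (cross z w / dotp z w).

(** Multiplication by the complex number rho e^(i a). *)
Definition rot_scale (rho a : R) z : R * R :=
  (rho * (cos a * z.1 - sin a * z.2), rho * (cos a * z.2 + sin a * z.1)).

Lemma rot_scaleD rho sigma a b z :
  rot_scale rho a (rot_scale sigma b z) = rot_scale (rho * sigma) (b + a) z.
Proof. by rewrite /rot_scale /= cosD sinD; congr pair; ring. Qed.

Lemma angleP z w : 0 < dotp z w ->
  exists2 rho, 0 < rho & w = rot_scale rho (angle z w) z.
Proof.
move=> d0; set a := angle z w.
have ca : 0 < cos a.
  by rewrite cos_atan invr_gt0 sqrtr_gt0 ltr_pwDl// sqr_ge0.
have sa : sin a = cross z w / dotp z w * cos a.
  rewrite -[X in X * _]atanK -/(angle z w) -/a /tan -mulrA mulVf ?mulr1//.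
  exact: lt0r_neq0.
have z0 : 0 < dotp z z.
  rewrite lt_neqAle; apply/andP; split; last by rewrite addr_ge0// -expr2 sqr_ge0.
  apply: contraTneq d0 => /esym /eqP.
  rewrite /dotp -!expr2 paddr_eq0 ?sqr_ge0// !sqrf_eq0 => /andP[/eqP-> /eqP->].
  by rewrite !mul0r addr0 ltxx.
(* The real part of the quotient w / z is [dotp z w / dotp z z], and it has to equal rho cos a. *)
exists (dotp z w / (cos a * dotp z z)); first by rewrite divr_gt0// mulr_gt0.
have [dn cn zn] : [/\ dotp z w != 0, cos a != 0 & dotp z z != 0].
  by split; exact: lt0r_neq0.
rewrite /rot_scale sa; case: w d0 @a ca sa dn cn => w1 w2 /= d0 ca sa dn cn.
have E1 : w1 * dotp z z = dotp z (w1, w2) * z.1 - cross z (w1, w2) * z.2.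
  by rewrite /dotp /cross /=; ring.
have E2 : w2 * dotp z z = dotp z (w1, w2) * z.2 + cross z (w1, w2) * z.1.
  by rewrite /dotp /cross /=; ring.
by congr pair; apply: (mulIf zn); rewrite ?E1 ?E2; field; rewrite dn cn zn.
Qed.

Lemma rot_scale_cos rho a z : z <> (0, 0) -> 0 < rho ->
  (rot_scale rho a z = z -> cos a = 1) /\
  (rot_scale rho a z = (- z.1, - z.2) -> cos a = - 1).
Proof.
move=> z0 rho0.
have zz : z.1 ^+ 2 + z.2 ^+ 2 != 0.
  apply: contra_notN z0; rewrite paddr_eq0 ?sqr_ge0// !sqrf_eq0.
  by case: z => ? ? /= /andP[/eqP-> /eqP->].
(* Here [e] is the sign 1 or -1: once sin a = 0, cos a is 1 or -1, and the second premise selects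
   which. *)
have H e : e ^+ 2 = 1 -> 0 <= e * cos a * rho ->
    rho * sin a = 0 -> cos a = e.
  move=> e1 ec /eqP; rewrite mulf_eq0 gt_eqF//= => /eqP s0.
  have := cos2Dsin2 a; rewrite s0 expr0n addr0 => c1.
  have : (cos a - e) * (cos a + e) = 0 by rewrite -subr_sqr c1 e1 subrr.
  move/eqP; rewrite mulf_eq0 => /orP[|]; first by rewrite subr_eq0 => /eqP.
  rewrite addr_eq0 => /eqP ce; move: ec.
  by rewrite ce mulrN -expr2 e1 mulNr mul1r oppr_ge0 leNgt rho0.
move: zz; rewrite /rot_scale; case: (z) => x y /= zz.
split=> [[e1 e2]|[e1 e2]].
(* The dot and cross products of the equation with z isolate rho cos a and rho sin a. *)
- have c : (rho * cos a - 1) * (x ^+ 2 + y ^+ 2) = 0.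
    transitivity (x * (rho * (cos a * x - sin a * y)) +
       y * (rho * (cos a * y + sin a * x)) - (x ^+ 2 + y ^+ 2)); first by ring.
    by rewrite e1 e2; ring.
  have s : rho * sin a * (x ^+ 2 + y ^+ 2) = 0.
    transitivity (x * (rho * (cos a * y + sin a * x)) -
       y * (rho * (cos a * x - sin a * y))); first by ring.
    by rewrite e1 e2; ring.
  move/eqP: c; rewrite mulf_eq0 (negPf zz) orbF subr_eq0 => /eqP c.
  move/eqP: s; rewrite mulf_eq0 (negPf zz) orbF => /eqP s.
  by apply: (H 1 (expr1n _ _) _ s); rewrite mul1r mulrC c.
- have c : (rho * cos a + 1) * (x ^+ 2 + y ^+ 2) = 0.
    transitivity (x * (rho * (cos a * x - sin a * y)) +
       y * (rho * (cos a * y + sin a * x)) + (x ^+ 2 + y ^+ 2)); first by ring.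
    by rewrite e1 e2; ring.
  have s : rho * sin a * (x ^+ 2 + y ^+ 2) = 0.
    transitivity (x * (rho * (cos a * y + sin a * x)) -
       y * (rho * (cos a * x - sin a * y))); first by ring.
    by rewrite e1 e2; ring.
  move/eqP: c; rewrite mulf_eq0 (negPf zz) orbF addr_eq0 => /eqP c.
  move/eqP: s; rewrite mulf_eq0 (negPf zz) orbF => /eqP s.
  apply: (H (-1) _ _ s); first by rewrite sqrrN expr1n.
  by rewrite mulN1r mulNr mulrC c opprK.
Qed.

(** Guarantees that close enough samples of F make an angle below a right angle, the range in which
    [angle] is correct. If the l1 norm u + v of F z is at least e and each coordinate varies by less
    than e / 4, the dot product is at least u^2 + v^2 - (u + v) e / 4, while e (u + v) <= (u + v)^2
    <= 2 (u^2 + v^2). *)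
Lemma dotp_gt0_uniform (F : R * R -> R * R) :
  {within square, continuous F} -> (forall z, square z -> F z <> (0, 0)) ->
  exists2 d : R, 0 < d & forall z w, square z -> square w -> ball z d w ->
    0 < dotp (F z) (F w).
Proof.
move=> cF F0; pose m z := `|(F z).1| + `|(F z).2|.
have cm : {within square, continuous m}.
  apply: within_add; apply: within_norm; [exact: within_fst|exact: within_snd].
have [c sc cmin] : exists2 c, c \in square & forall t, t \in square -> m c <= m t.
  apply: compact_EVT_min => //; last exact: square_compact.
  by exists (0, 0); split; rewrite /= in_itv /= lexx ler01.
rewrite inE in sc.
have m0 : 0 < m c.
  rewrite lt_neqAle addr_ge0// andbT eq_sym paddr_eq0// !normr_eq0.
  by apply: contra_notN (F0 _ sc); case: (F c) => ? ? /= /andP[/eqP-> /eqP->].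
have m40 : 0 < m c / 4 by rewrite divr_gt0.
have [d d0 H] := within_compact_unif square_compact cF m40.
exists d => // z w sz sw /(H _ _ sz sw) [].
rewrite /ball /= /dotp.
have : m c <= `|(F z).1| + `|(F z).2| by apply: cmin; rewrite inE.
move: (m c) m0 => e.
case: (F z) (F w) => [a b] [a' b'] /= e0 ez.
rewrite {H m40}; move=> Ha Hb.
have P x x' : `|x - x'| < e / 4 -> `|x| ^+ 2 - `|x| * (e / 4) <= x * x'.
  move=> xx'; rewrite real_normK ?num_real//.
  have -> : x * x' = x ^+ 2 - x * (x - x') by ring.
  rewrite lerD2l lerN2; apply: le_trans (ler_norm _) _.
  by rewrite normrM ler_wpM2l// ltW.
apply: lt_le_trans (lerD (P _ _ Ha) (P _ _ Hb)).
have u0 : 0 <= `|a| by []. have v0 : 0 <= `|b| by [].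
move: `|a| `|b| u0 v0 ez => u v u0 v0 ez.
have E : e * (u + v) <= (u + v) ^+ 2 by rewrite expr2 ler_wpM2r// addr_ge0.
have E' : 0 < e * (u + v) by rewrite mulr_gt0// (lt_le_trans e0).
have := sqr_ge0 (u - v).
rewrite sqrrB; move: E; rewrite sqrrD; lra.
Qed.

(* If [W r] is the total angle swept by the loop [F (r, _)], then [cos (W r) = 1]
   as the loop closes up, so [cos (W r / 2)] is continuous with values in
   [{1, -1}]; but it is [1] at [r = 0] and [- 1] at [r = 1]. *)
Lemma no_antipodal_loop (F : R * R -> R * R) :
  {within square, continuous F} -> (forall z, square z -> F z <> (0, 0)) ->
  (forall s : R, `[0, 1]%classic s -> F (0, s) = F (0, 0)) ->
  (forall r : R, `[0, 1]%classic r -> F (r, 1) = F (r, 0)) ->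
  (forall s : R, `[0, 2^-1]%classic s ->
    F (1, s + 2^-1) = (- (F (1, s)).1, - (F (1, s)).2)) -> False.
Proof.
move=> cF F0 Fc Fp Fa.
have [d d0 Fd] := dotp_gt0_uniform cF F0.
have [n n0 nd] : exists2 n : nat, (0 < n)%N & n%:R^-1 < d.
  have [n _ /(_ n (leqnn _)) H] := near_infty_natSinv_lt (PosNum d0).
  by exists n.+1.
(* The number of samples is even, so that half a period is a shift by exactly n indices. *)
pose t k : R := k%:R / (2 * n)%:R.
have nn0 : (0 : R) < (2 * n)%:R by rewrite ltr0n muln_gt0.
have tS k : t k.+1 = t k + (2 * n)%:R^-1.
  by rewrite /t -addn1 natrD mulrDl mul1r.
have t01 k : (k <= 2 * n)%N -> `[0, 1]%classic (t k).
  move=> kn; rewrite /= in_itv /= divr_ge0 ?ler0n//=.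
  by rewrite ler_pdivrMr// mul1r ler_nat.
have tn : t n = 2^-1.
  rewrite /t natrM invfM mulrCA mulfV ?mulr1// pnatr_eq0 -lt0n//.
have t2n : t (2 * n)%N = 1 by rewrite /t mulfV// lt0r_neq0.
have tDn k : t (n + k)%N = t k + 2^-1.
  by rewrite /t natrD mulrDl addrC -/(t n) tn.
have sq r k : `[0, 1]%classic r -> (k <= 2 * n)%N -> square (r, t k).
  by move=> r1 kn; split => //; exact: t01.
have Fdk r k : `[0, 1]%classic r -> (k < 2 * n)%N ->
    0 < dotp (F (r, t k)) (F (r, t k.+1)).
  move=> r1 kn; apply: Fd; [exact/sq/ltnW|exact: sq|].
  split; first exact: ballxx.
  rewrite /ball /= tS opprD addNKr normrN gtr0_norm ?invr_gt0//.
  apply: le_lt_trans nd; rewrite lef_pV2 ?posrE// ?ltr0n// ler_nat.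
  by rewrite leq_pmull.
pose a r k := angle (F (r, t k)) (F (r, t k.+1)).
pose A r k := \sum_(j < k) a r j.
have FA r k : `[0, 1]%classic r -> (k <= 2 * n)%N ->
    exists2 rho, 0 < rho & F (r, t k) = rot_scale rho (A r k) (F (r, t 0%N)).
  move=> r1; elim: k => [|k IH] kn.
    exists 1 => //; rewrite /A big_ord0 /rot_scale cos0 sin0 !mul1r !mul0r subr0 addr0.
    by case: (F _).
  have [rho rho0 E] := IH (ltnW kn).
  have [sig sig0 E'] := angleP (Fdk _ _ r1 kn).
  exists (sig * rho); first exact: mulr_gt0.
  by rewrite E' {2}E rot_scaleD /A big_ord_recr.
have i0 : `[0, 1]%classic (0 : R) by rewrite /= in_itv /= lexx ler01.
have i1 : `[0, 1]%classic (1 : R) by rewrite /= in_itv /= lexx ler01.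
have sq0 (r : R) : `[0, 1]%classic r -> square (r, 0) by move=> r1; split.
have t0 : t 0%N = 0 by rewrite /t mul0r.
have W1 r : `[0, 1]%classic r -> cos (A r (2 * n)%N) = 1.
  move=> r1; have [rho rho0] := FA r _ r1 (leqnn _).
  rewrite t2n t0 Fp// => E.
  have [H _] := rot_scale_cos (A r (2 * n)%N) (F0 _ (sq0 r r1)) rho0.
  exact: H.
have W0 : A 0 (2 * n)%N = 0.
  have Fcc z : cross z z = 0 by rewrite /cross mulrC subrr.
  rewrite /A big1// => j _; rewrite /a !Fc; [|exact: t01|exact/t01/ltnW].
  by rewrite /angle Fcc mul0r atan0.
(* The second half of the loop is the negative of the first, and [angle] is unchanged when both its
   arguments change sign. *)
have half : A 1 (2 * n)%N = A 1 n *+ 2.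
  rewrite /A mul2n -addnn big_split_ord /= mulr2n; congr (_ + _).
  apply: eq_bigr => j _; rewrite /a -addnS !tDn !Fa.
  - by rewrite /angle /cross /dotp /= !mulrNN.
  - by rewrite /= in_itv /= -tn /t divr_ge0 ?ler0n//= ler_pM2r ?invr_gt0// ler_nat.
  - by rewrite /= in_itv /= -tn /t divr_ge0 ?ler0n//= ler_pM2r ?invr_gt0// ler_nat ltnW.
have cn : cos (A 1 n) = - 1.
  have [|rho rho0] := FA 1 n i1; first by rewrite leq_pmull.
  rewrite tn t0 -[2^-1]add0r Fa; last first.
    by rewrite /= in_itv /= lexx invr_ge0 ler0n.
  move=> E; have [_ H] := rot_scale_cos (A 1 n) (F0 _ (sq0 1 i1)) rho0.
  exact: H.
have cA : {within `[0, 1], continuous (fun r => A r (2 * n)%N)}.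
  have cF' k : (k <= 2 * n)%N -> {within `[0, 1], continuous (fun r => F (r, t k))}.
    move=> kn; apply: (within_comp cF) => [|r r1]; last exact: sq.
    by apply: within_pair; [exact: within_id|exact: within_cst].
  suff H k : (k <= 2 * n)%N -> {within `[0, 1], continuous (fun r => A r k)} by exact: H.
  elim: k => [|k IH] kn.
    apply: (@within_ext _ _ _ (fun=> 0)); last exact: within_cst.
    by move=> r _; rewrite /A big_ord0.
  apply: (@within_ext _ _ _ (fun r => A r k + a r k)).
    by move=> r _; rewrite /A big_ord_recr.
  apply: within_add; first exact/IH/ltnW.
  apply: within_cont; first exact: continuous_atan.
  have [c1 c2] := (cF' _ (ltnW kn), cF' _ kn).
  apply: within_mul.
    apply: within_add; first by apply: within_mul; [exact: within_fst|exact: within_snd].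
    by apply: within_opp; apply: within_mul; [exact: within_snd|exact: within_fst].
  apply: within_inv; first by move=> r r1; apply: lt0r_neq0; exact: Fdk.
  by apply: within_add; apply: within_mul; by [exact: within_fst|exact: within_snd].
have [|||c c1] := @IVT R (fun r => cos (A r (2 * n)%N / 2)) 0 1 0.
- exact: ler01.
- apply: within_cont; first exact: continuous_cos.
  by apply: within_mul => //; exact: within_cst.
- rewrite W0 mul0r cos0 half -[_ *+ 2]mulr_natr mulfK ?pnatr_eq0// cn.
  by rewrite ge_min le_max oppr_le0 ler01 orbT.
move=> c0; have := W1 c; rewrite /= => /(_ c1).
rewrite [X in cos X]splitr -mulr2n cos_mulr2n c0 expr0n /= mul0rn sub0r; lra.
Qed.

End Winding.

(** * Invariance of domain in the plane *)

Section InvarianceOfDomain.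
Context {R : realType}.

Lemma open_open_disk : open (open_disk : set (R * R)).
Proof.
have c : continuous (fun z : R * R => z.1 ^+ 2 + z.2 ^+ 2).
  move=> z; apply: cvgD; apply: (@cvgM _ _ (nbhs z)); by [exact: cvg_fst|exact: cvg_snd].
have -> : open_disk = (fun z : R * R => z.1 ^+ 2 + z.2 ^+ 2) @^-1` [set x | x < 1] by [].
by apply: open_comp => //; exact: open_lt.
Qed.

Lemma disk_compact : compact (disk : set (R * R)).
Proof.
have c : continuous (fun z : R * R => z.1 ^+ 2 + z.2 ^+ 2).
  move=> z; apply: cvgD; apply: (@cvgM _ _ (nbhs z)); by [exact: cvg_fst|exact: cvg_snd].
apply: (@subclosed_compact _ _ (`[-1, 1]%classic `*` `[-1, 1]%classic : set (R * R))).
- have -> : disk = (fun z : R * R => z.1 ^+ 2 + z.2 ^+ 2) @^-1` [set x | x <= 1] by [].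
  by apply: preimage_closed => //; exact: closed_le.
- by apply: compact_setX; exact: segment_compact.
- by move=> [x y]; rewrite /disk /= => xy; split; rewrite /= in_itv /=; nra.
Qed.

Lemma open_disk_sub : open_disk `<=` (disk : set (R * R)).
Proof. by move=> z /ltW. Qed.

(* If [y] near [h z0] is omitted by [h], the loops [h (z0 + a u) - y], for
   [0 <= a <= 1], followed by a translation of [y] to [h z0] and then by the
   loops [h (z0 + u) - h (z0 - c u)], contract the antipodal loop
   [h (z0 + u) - h (z0 - u)] to a point in the complement of the origin. *)
Lemma invariance_of_domain (h : R * R -> R * R) :
  {within disk, continuous h} -> {in disk &, injective h} ->
  open (h @` open_disk).
Proof.
move=> ch hinj; rewrite openE => _ [z0 z0D <-]; rewrite /interior.
have := open_open_disk; rewrite openE => /(_ _ z0D) /nbhs_ballP[e0 /= e00 He].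
have [rho rho0 rhoe] : exists2 rho, 0 < rho & rho < e0.
  by exists (e0 / 2); rewrite ?divr_gt0// ltr_pdivrMr// ltr_pMr// ltr1n.
pose c (s : R) := rho * cos (pi *+ 2 * s).
pose d (s : R) := rho * sin (pi *+ 2 * s).
pose P (a s : R) : R * R := (z0.1 + a * c s, z0.2 + a * d s).
have Hr (x u : R) : `|x| <= 1 -> `|u| <= 1 -> `|x * (rho * u)| < e0.
  move=> x1 u1; rewrite mulrCA normrM (gtr0_norm rho0) normrM; apply: le_lt_trans rhoe.
  by rewrite ler_piMr ?(ltW rho0)// mulr_ile1.
have PD a s : `|a| <= 1 -> open_disk (P a s).
  move=> a1; apply: He; split; rewrite /ball /= opprD addNKr normrN; apply: Hr => //.
    exact: cos_max.
  exact: sin_max.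
have PD' a s : `|a| <= 1 -> disk (P a s) by move=> /PD /open_disk_sub.
have P0 s : P 0 s = z0 by rewrite /P !mul0r !addr0 -surjective_pairing.
have Pinj a b s : P a s = P b s -> a = b.
  case=> /addrI e1 /addrI e2.
  have : (a - b) * (c s ^+ 2 + d s ^+ 2) = 0.
    transitivity ((a * c s - b * c s) * c s + (a * d s - b * d s) * d s); first by ring.
    by rewrite e1 e2 !subrr !mul0r addr0.
  move/eqP; rewrite /c /d !exprMn -mulrDr cos2Dsin2 mulr1 mulf_eq0 sqrf_eq0.
  by rewrite (gt_eqF rho0) orbF subr_eq0 => /eqP.
have hP a b s : `|a| <= 1 -> `|b| <= 1 -> h (P a s) = h (P b s) -> a = b.
  by move=> a1 b1 /hinj; rewrite !inE => /(_ (PD' _ _ a1) (PD' _ _ b1)); exact: Pinj.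
have cc (S : topologicalType) (A : set S) (a s : S -> R) : {within A, continuous a} ->
    {within A, continuous s} -> (forall x, A x -> `|a x| <= 1) ->
    {within A, continuous (fun x => h (P (a x) (s x)))}.
  move=> ca cs a1; apply: (within_comp ch) => [|x Ax]; last exact/PD'/a1.
  have cps : {within A, continuous (fun x => pi *+ 2 * s x)}.
    by apply: within_mul => //; exact: within_cst.
  apply: within_pair; apply: within_add; try exact: within_cst.
    apply: within_mul => //; apply: within_mul; first exact: within_cst.
    exact: (within_cont (@continuous_cos R)).
  apply: within_mul => //; apply: within_mul; first exact: within_cst.
  exact: (within_cont (@continuous_sin R)).
pose n1 (w : R * R) := `|w.1 - (h z0).1| + `|w.2 - (h z0).2|.
have [M M0 HM] : exists2 M : R, 0 < M & forall s, `[0, 1]%classic s -> M <= n1 (h (P 1 s)).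
  have ci : {within `[0, 1], continuous (fun s => h (P 1 s))}.
    by apply: cc; [exact: within_cst|exact: within_id|rewrite normr1].
  have [|s s01 smin] := @EVT_min R (fun s => n1 (h (P 1 s))) 0 1 ler01.
    apply: within_add; apply: within_norm; apply: within_add; try exact: within_cst.
      exact: within_fst.
    exact: within_snd.
  exists (n1 (h (P 1 s))); last by move=> t t01; exact: smin.
  rewrite lt_neqAle addr_ge0// andbT eq_sym paddr_eq0// !normr_eq0 !subr_eq0.
  apply/negP => /andP[/eqP e1 /eqP e2].
  have : h (P 1 s) = h (P 0 s).
    by rewrite P0 [LHS]surjective_pairing e1 e2 -surjective_pairing.
  by move/hP; rewrite normr1 normr0 => /(_ (lexx _) ler01) /eqP; rewrite oner_eq0.
(* Balls of the plane are those of the max metric: M / 2 for each coordinate gives M for the l1 norm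
   [n1]. *)
apply/nbhs_ballP; exists (M / 2) => /=; first by rewrite divr_gt0.
move=> y yM; apply: contrapT => ny.
have yh z : open_disk z -> h z <> y by move=> zD hzy; apply: ny; exists z.
have yn1 : n1 y < M.
  case: yM; rewrite /ball /= /n1 distrC => ? ?.
  by rewrite [`|y.2 - _|]distrC [M]splitr ltrD.
(* The three stages occupy the thirds of [0, 1]: [a] grows from 0 to 1, then [b] carries y to h z0,
   then [k] decreases from 0 to -1. *)
pose a (r : R) := Num.min 1 (3 * r).
pose b (r : R) := Num.min 1 (Num.max 0 (3 * r - 1)).
pose k (r : R) := - Num.max 0 (3 * r - 2).
pose F (z : R * R) : R * R :=
  ((h (P (a z.1) z.2)).1 - (y.1 + b z.1 * ((h z0).1 - y.1) + (h (P (k z.1) z.2)).1 - (h z0).1),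
   (h (P (a z.1) z.2)).2 - (y.2 + b z.1 * ((h z0).2 - y.2) + (h (P (k z.1) z.2)).2 - (h z0).2)).
have a1 r : `[0, 1]%classic r -> `|a r| <= 1.
  rewrite /= in_itv /= => /andP[r0 r1].
  by rewrite ger0_norm ?ge_min ?lexx// le_min ler01 mulr_ge0.
have k1 r : `[0, 1]%classic r -> `|k r| <= 1.
  rewrite /= in_itv /= => /andP[r0 r1].
  by rewrite normrN ger0_norm ?le_max ?lexx// ge_max ler01/=; lra.
have sc r s : square (r, s) -> `[0, 1]%classic r /\ `[0, 1]%classic s by [].
apply: (@no_antipodal_loop R F).
- have c1 : {within square, continuous (fun z : R * R => z.1)}.
    by apply: within_fst; exact: within_id.
  have c2 : {within square, continuous (fun z : R * R => z.2)}.
    by apply: within_snd; exact: within_id.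
  have c3 : {within square, continuous (fun z : R * R => 3 * z.1)}.
    by apply: within_mul => //; exact: within_cst.
  have ca : {within square, continuous (fun z : R * R => h (P (a z.1) z.2))}.
    apply: cc => //; last by move=> [r s] /sc[? _]; exact: a1.
    by apply: within_min => //; exact: within_cst.
  have ck : {within square, continuous (fun z : R * R => h (P (k z.1) z.2))}.
    apply: cc => //; last by move=> [r s] /sc[? _]; exact: k1.
    apply: within_opp; apply: within_max; first exact: within_cst.
    by apply: within_add => //; exact: within_cst.
  have cb : {within square, continuous (fun z : R * R => b z.1)}.
    apply: within_min; first exact: within_cst.
    apply: within_max; first exact: within_cst.
    by apply: within_add => //; exact: within_cst.
  apply: within_pair; apply: within_add.
  + exact: within_fst.
  + apply: within_opp; apply: within_add; last exact: within_cst.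
    apply: within_add; last exact: within_fst.
    apply: within_add; first exact: within_cst.
    by apply: within_mul => //; exact: within_cst.
  + exact: within_snd.
  + apply: within_opp; apply: within_add; last exact: within_cst.
    apply: within_add; last exact: within_snd.
    apply: within_add; first exact: within_cst.
    by apply: within_mul => //; exact: within_cst.
(* Each third avoids the origin for its own reason: y is not a value of h; y and the segment to h z0
   are nearer to h z0 than the loop; h is injective and k r <= 0 < 1 = a r. *)
- move=> [r s] /sc[r01 s01].
  have ar := a1 _ r01; have kr := k1 _ r01.
  move: r01; rewrite /= in_itv /= => /andP[r0 r1].
  case=> e1 e2.
  have [r13|r13] := lerP r (3^-1).
    have b0 : b r = 0.
      by rewrite /b (@max_l _ _ 0) ?(@min_r _ _ 1)//; lra.
    have k0 : k r = 0 by rewrite /k (@max_l _ _ 0) ?oppr0//; lra.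
    apply: (yh _ (PD _ s ar)).
    move: e1 e2; rewrite k0 b0 P0 !mul0r !addr0 !addrK => /eqP + /eqP.
    rewrite !subr_eq0 => /eqP e1 /eqP e2.
    by rewrite [LHS]surjective_pairing e1 e2 -surjective_pairing.
  have ar1 : a r = 1 by rewrite /a min_l//; lra.
  have [r23|r23] := lerP r (2 / 3).
    have k0 : k r = 0 by rewrite /k (@max_l _ _ 0) ?oppr0//; lra.
    have b01 : 0 <= b r <= 1 by rewrite /b ge_min lexx/= le_min ler01 le_max lexx.
    have := HM _ s01; rewrite leNgt => /negP; apply.
    apply: le_lt_trans yn1.
    move: e1 e2; rewrite k0 ar1 P0 !addrK => /eqP + /eqP.
    rewrite !subr_eq0 /n1 => /eqP-> /eqP->.
    have E (p q : R) : p + b r * (q - p) - q = (1 - b r) * (p - q) by ring.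
    rewrite !E !normrM -mulrDr ler_piMl ?addr_ge0// ger0_norm; lra.
  have b1 : b r = 1 by rewrite /b (@max_r _ _ 0) ?(@min_l _ _ 1)//; lra.
  have : h (P (a r) s) = h (P (k r) s).
    move: e1 e2; rewrite b1 !mul1r.
    move=> e1 e2; rewrite [LHS]surjective_pairing [RHS]surjective_pairing; congr pair; lra.
  move/hP => /(_ ar kr); rewrite ar1 /k max_r; lra.
- move=> s _; rewrite /F /=.
  have -> : a 0 = 0 by rewrite /a mulr0 min_r.
  have -> : k 0 = 0 by rewrite /k mulr0 max_l ?oppr0//; lra.
  by rewrite !P0.
- move=> r _; rewrite /F /=.
  have E x : P x 1 = P x 0.
    rewrite /P /c /d mulr1 mulr0 -[pi *+ 2]add0r.
    by rewrite cosD2pi sinD2pi.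
  by rewrite !E.
- move=> s _; rewrite /F /=.
  have E x : P x (s + 2^-1) = P (- x) s.
    have -> : P x (s + 2^-1) = (z0.1 + x * (rho * cos (pi *+ 2 * s + pi)), z0.2 + x * (rho * sin (pi *+ 2 * s + pi))).
      have pi2 : pi *+ 2 * 2^-1 = pi :> R.
        by rewrite -[_ *+ 2]mulr_natr mulfK ?pnatr_eq0.
      by rewrite /P /c /d mulrDr pi2.
    by rewrite cosDpi sinDpi /P !mulrN !mulNr.
  have -> : a 1 = 1 by rewrite /a min_l//; lra.
  have -> : k 1 = -1 by rewrite /k max_r//; lra.
  have -> : b 1 = 1 by rewrite /b max_r ?min_l//; lra.
  by rewrite !E opprK; congr pair; ring.
Qed.

End InvarianceOfDomain.

(** * Collapsing disjoint cells to distinct heights *)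

Section PlanarBalls.
Context {R : realType}.

Definition enorm (z : R * R) : R := Num.sqrt (z.1 ^+ 2 + z.2 ^+ 2).

Lemma enorm_ge0 z : 0 <= enorm z. Proof. exact: sqrtr_ge0. Qed.

Lemma enorm_sqr z : enorm z ^+ 2 = z.1 ^+ 2 + z.2 ^+ 2.
Proof. by rewrite sqr_sqrtr// addr_ge0 ?sqr_ge0. Qed.

Lemma enorm_lt1 z : (enorm z < 1) = (z.1 ^+ 2 + z.2 ^+ 2 < 1).
Proof. by rewrite -enorm_sqr expr_lt1 ?enorm_ge0. Qed.

Lemma enorm_le1 z : (enorm z <= 1) = (z.1 ^+ 2 + z.2 ^+ 2 <= 1).
Proof. by rewrite -enorm_sqr expr_le1 ?enorm_ge0. Qed.

Lemma within_enorm (S : topologicalType) (A : set S) (f : S -> R * R) :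
  {within A, continuous f} -> {within A, continuous (fun x => enorm (f x))}.
Proof.
move=> cf; apply: within_sqrt.
by apply: within_add; apply: within_mul; by [exact: within_fst|exact: within_snd].
Qed.

Lemma normr_le_enorm z : `|z.1| <= enorm z /\ `|z.2| <= enorm z.
Proof.
by split; rewrite -(@ler_pXn2r _ 2%N) ?nnegrE ?enorm_ge0// real_normK ?num_real//
  enorm_sqr ?lerDl ?lerDr sqr_ge0.
Qed.

(* [z] is pushed away from [c] by [lam (1 - |z|^2) (z - c)], then projected
   radially onto the disk. Near the circle this does not decrease the norm;
   elsewhere, points at distance at least [rho] from [c] land on the circle. *)
Lemma disk_push (c : R * R) (r rho : R) : open_disk c -> r < 1 -> 0 < rho ->
  exists s : R * R -> R * R,
  [/\ {within disk, continuous s},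
      forall z, disk z -> disk (s z),
      forall z, z.1 ^+ 2 + z.2 ^+ 2 = 1 -> s z = z &
      forall z, disk z -> enorm (s z) <= r ->
        `|z.1 - c.1| < rho /\ `|z.2 - c.2| < rho].
Proof.
move=> cD r1 rho0.
have c1 : enorm c < 1 by rewrite enorm_lt1.
(* Since q dominates |c|, beyond norm q the push away from c has a nonnegative radial component, by
   Cauchy-Schwarz. *)
pose q := Num.max r (enorm c).
have q1 : q < 1 by rewrite gt_max r1 c1.
have rq : r <= q by rewrite le_max lexx.
have cq : enorm c <= q by rewrite le_max lexx orbT.
have q0 : 0 <= q by apply: le_trans cq; exact: enorm_ge0.
clearbody q.
have q2 : q ^+ 2 < 1 by rewrite expr_lt1.
(* Chosen so that, inside the disk of radius q, a coordinate at distance at least rho from that of c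
   is moved by at least 2, hence out of ]-1, 1[. *)
pose lam := 2 / ((1 - q ^+ 2) * rho).
have lam0 : 0 < lam by rewrite divr_gt0// mulr_gt0// subr_gt0.
pose k z := lam * (1 - enorm z ^+ 2).
pose w (z : R * R) := (z.1 + k z * (z.1 - c.1), z.2 + k z * (z.2 - c.2)).
pose n z := Num.max 1 (enorm (w z)).
have n1 z : 1 <= n z by rewrite le_max lexx.
have n0 z : 0 < n z by apply: lt_le_trans (n1 z).
have wn z : enorm (w z) <= n z by rewrite le_max lexx orbT.
pose s z := ((w z).1 / n z, (w z).2 / n z).
have sE z : enorm (s z) = enorm (w z) / n z.
  have : enorm (s z) ^+ 2 = (enorm (w z) / n z) ^+ 2.
    by rewrite expr_div_n !enorm_sqr mulrDl -!expr_div_n.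
  by move/eqP; rewrite eqrXn2 ?divr_ge0 ?enorm_ge0 ?(ltW (n0 _))// => /eqP.
have k0 z : disk z -> 0 <= k z.
  by move=> zD; rewrite mulr_ge0 ?(ltW lam0)// subr_ge0 enorm_sqr.
exists s; split.
- have c1' : {within disk, continuous (fun z : R * R => z.1)}.
    by apply: within_fst; exact: within_id.
  have c2' : {within disk, continuous (fun z : R * R => z.2)}.
    by apply: within_snd; exact: within_id.
  have ce : {within disk, continuous enorm} by apply: within_enorm; exact: within_id.
  have ck : {within disk, continuous k}.
    apply: within_mul; first exact: within_cst.
    apply: within_add; first exact: within_cst.
    by apply: within_opp; apply: within_mul.
  have cw : {within disk, continuous w}.
    apply: within_pair; apply: within_add => //; apply: within_mul => //;
      apply: within_add => //; exact: within_cst.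
  have cn : {within disk, continuous (fun z => (n z)^-1)}.
    apply: within_inv; first by move=> z _; exact: lt0r_neq0.
    by apply: within_max; [exact: within_cst|exact: within_enorm].
  by apply: within_pair; apply: within_mul => //; by [exact: within_fst|exact: within_snd].
- move=> z zD; have : enorm (s z) <= 1 by rewrite sE ler_pdivrMr// mul1r.
  by rewrite enorm_le1.
- move=> z z1; have kz : k z = 0 by rewrite /k enorm_sqr z1 subrr mulr0.
  have wz : w z = z by rewrite /w kz !mul0r !addr0 -surjective_pairing.
  have nz : n z = 1.
    by rewrite /n wz max_l// enorm_le1 z1.
  by rewrite /s nz !divr1 wz -surjective_pairing.
- move=> z zD sr.
  have kz := k0 z zD.
  have sq : enorm (s z) <= q by exact: le_trans sr rq.
  have wq : enorm (w z) <= q.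
    move: sq; rewrite sE; have [w1|w1] := lerP 1 (enorm (w z)).
      have -> : n z = enorm (w z) by rewrite /n max_r.
      by rewrite mulfV ?gt_eqF ?(lt_le_trans ltr01)// leNgt q1.
    by have -> : n z = 1 by [rewrite /n max_l// ltW]; rewrite divr1.
  have w1 : enorm (w z) < 1 by exact: le_lt_trans q1.
  have zq : enorm z <= q.
    rewrite leNgt; apply/negP => qz.
    have zw : enorm z <= enorm (w z).
      have z0 : 0 < enorm z by exact: le_lt_trans qz.
      have CS (a b : R * R) : a.1 * b.1 + a.2 * b.2 <= enorm a * enorm b.
        apply: le_trans (ler_norm _) _.
        rewrite -(@ler_pXn2r _ 2%N) ?nnegrE ?mulr_ge0 ?enorm_ge0//.
        rewrite exprMn !enorm_sqr real_normK ?num_real//.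
        have := sqr_ge0 (a.1 * b.2 - a.2 * b.1); nra.
      rewrite -(@ler_pM2r _ (enorm z))//; apply: le_trans (CS _ _).
      have cz : c.1 * z.1 + c.2 * z.2 <= enorm z ^+ 2.
        apply: le_trans (CS _ _) _; rewrite expr2 ler_wpM2r ?enorm_ge0//.
        by apply: le_trans (ltW qz).
      have : 0 <= k z * (enorm z ^+ 2 - (c.1 * z.1 + c.2 * z.2)).
        by rewrite mulr_ge0// subr_ge0.
      have := enorm_sqr z; rewrite -expr2 /w /= => ->; lra.
    by move: (lt_le_trans qz zw); rewrite ltNge wq.
  have kb : 2 <= k z * rho.
    rewrite /k /lam; apply: (@le_trans _ _ (2 / ((1 - q ^+ 2) * rho) * (1 - q ^+ 2) * rho)).
      by rewrite -mulrA divfK// gt_eqF// mulr_gt0// subr_gt0.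
    rewrite ler_wpM2r ?(ltW rho0)// ler_wpM2l ?(ltW lam0)//.
    by rewrite lerD2l lerN2 ler_pXn2r ?nnegrE ?enorm_ge0.
  have key x y : `|x| <= 1 -> `|x + k z * y| < 1 -> `|y| < rho.
    move=> x1 xy; rewrite ltNge; apply/negP => ry.
    have : 2 <= `|k z * y|.
      by rewrite normrM (ger0_norm kz); apply: le_trans kb _; rewrite ler_wpM2l.
    have := ler_normB (x + k z * y) x; rewrite addrAC subrr add0r; lra.
  have [wz1 wz2] := normr_le_enorm (w z).
  have [zz1 zz2] := normr_le_enorm z.
  have z1 : enorm z <= 1 by rewrite enorm_le1.
  split; [apply: (key z.1)|apply: (key z.2)].
  + exact: le_trans z1.
  + exact: le_lt_trans wz1 w1.
  + exact: le_trans z1.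
  + exact: le_lt_trans wz2 w1.
Qed.

Lemma homeomorphism_on_image (B : set (R * R)) (h : R * R -> R * R) :
  homeomorphism_on disk B h ->
  [/\ h @` disk = B, {in disk &, injective h}, compact B & closed B].
Proof.
move=> [[hf hi hs] ch _].
have hB : h @` disk = B.
  by apply/seteqP; split => [_ [z zD <-]|]; [exact: hf|exact: hs].
have cB : compact B.
  by rewrite -hB; apply: continuous_compact => //; exact: disk_compact.
by split => //; apply: compact_closed => //; exact: norm_hausdorff.
Qed.

(** [disk_push] conjugated by the parametrization h. By compactness the parameters of K lie in a
    disk of radius r < 1, which the push reaches only from points near c; so K is reached only from
    points of B at almost the height of h c. *)
Lemma ball_collapse (B K : set (R * R)) (h : R * R -> R * R) (c : R * R) (tau : R) :
  homeomorphism_on disk B h -> closed K ->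
  (forall x, disk x -> K (h x) -> open_disk x) -> open_disk c -> 0 < tau ->
  exists phi : R * R -> R * R,
  [/\ {within B, continuous phi},
      forall z, B z -> B (phi z),
      forall z, B z -> ~ (h @` open_disk) z -> phi z = z &
      forall z, B z -> K (phi z) -> `|z.2 - (h c).2| < tau].
Proof.
move=> Hh cK HK cD tau0.
have [hB hinj cB clB] := homeomorphism_on_image Hh.
have [_ ch [k ck hk]] := Hh.
have kh x : disk x -> k (h x) = x by move=> xD; apply: hk; rewrite inE.
have Bh x : disk x -> B (h x) by rewrite -hB; exists x.
have kB z : B z -> disk (k z) /\ h (k z) = z.
  by rewrite -hB => -[x xD <-]; rewrite kh.
have [r r1 Hr] : exists2 r : R, r < 1 & forall x, disk x -> K (h x) -> enorm x <= r.
  pose L := k @` (B `&` K).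
  have LD x : L x -> disk x /\ K (h x).
    by move=> [z [zB zK] <-]; have [? ->] := kB _ zB.
  have DL x : disk x -> K (h x) -> L x by move=> xD xK; exists (h x); rewrite ?kh//; split => //; exact: Bh.
  (* When K misses the cell the condition is void, and 0 is an arbitrary radius below 1. *)
  have [L0|nL] := pselect (L !=set0); last first.
    by exists 0 => // x xD xK; case: nL; exists x; exact: DL.
  have cL : compact L.
    apply: continuous_compact.
      by apply: continuous_subspaceW ck; exact: subIsetl.
    by apply: subclosed_compact cB _ => //; exact: closedI.
  have [x0 x0L xmax] : exists2 x0, x0 \in L & forall t, t \in L -> enorm t <= enorm x0.
    by apply: compact_EVT_max => //; apply: within_enorm; exact: within_id.
  exists (enorm x0).
    by rewrite enorm_lt1; move: x0L; rewrite inE => /LD[x0D x0K]; exact: HK.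
  by move=> x xD xK; apply: xmax; rewrite inE; exact: DL.
have [rho rho0 Hrho] : exists2 rho : R, 0 < rho & forall x, disk x ->
    `|x.1 - c.1| < rho -> `|x.2 - c.2| < rho -> `|(h x).2 - (h c).2| < tau.
  have [d d0 Hd] := within_compact_unif disk_compact ch tau0.
  exists d => // x xD x1 x2.
  have [_] : ball (h c) tau (h x).
    by apply: Hd => //; [exact: open_disk_sub|split; rewrite /ball /= distrC].
  by rewrite /ball /= distrC.
have [s [cs sD s1 sr]] := disk_push cD r1 rho0.
exists (fun z => h (s (k z))); split.
- apply: (within_comp ch); last by move=> z /kB[? _]; exact: sD.
  by apply: (within_comp cs) => // z /kB[].
- by move=> z /kB[kD _]; exact/Bh/sD.
- move=> z /kB[kD hkz] nz; rewrite s1//.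
  apply/eqP; rewrite eq_le kD leNgt; apply/negP => k1.
  by apply: nz; exists (k z).
- move=> z /kB[kD hkz] zK.
  have [] := sr (k z) kD; first by apply: Hr => //; exact: sD.
  by rewrite -{3}hkz; exact: Hrho.
Qed.

(** Greedy choice: no finite list exhausts any of the sets, so the last one still offers an element
    different from those already chosen. *)
Lemma distinct_representatives (T : eqType) (m : nat) (H : 'I_m -> set T) :
  (forall i (l : seq T), exists2 x, x \notin l & H i x) ->
  exists2 s : 'I_m -> T, injective s & forall i, H i (s i).
Proof.
elim: m H => [|m IH] H HH.
  by exists (fun i : 'I_0 => match i with @Ordinal _ k p => match notF p with end end) => -[].
have [s sinj sH] := IH (fun i => H (widen_ord (leqnSn m) i)) (fun i => HH _).
have [x xl xH] := HH ord_max [seq s i | i <- enum 'I_m].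
have xs i : s i != x.
  by apply: contraNneq xl => <-; apply: map_f; rewrite mem_enum.
exists (fun i => if insub (val i) is Some j then s j else x).
- move=> i j; case: insubP => [i' _ ei|]; case: insubP => [j' _ ej|] //=.
  + by move=> /sinj ij; apply: val_inj; rewrite -ei -ej ij.
  + by move=> _ /eqP; rewrite (negPf (xs _)).
  + by move=> _ /esym/eqP; rewrite (negPf (xs _)).
  + rewrite -!leqNgt => mj mi _; apply: val_inj => /=.
    by apply/eqP; rewrite eqn_leq (leq_trans _ mj) ?(leq_trans _ mi)// -ltnS.
- move=> i; case: insubP => [j _ ej|].
    have -> : i = widen_ord (leqnSn m) j by apply: val_inj.
    exact: sH.
  rewrite -leqNgt => mi.
  have -> // : i = ord_max by apply: val_inj; apply/eqP; rewrite eqn_leq mi -ltnS ltn_ord.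
Qed.

Lemma ball_avoids_seq (l : seq R) (p e : R) : 0 < e ->
  exists2 y, y \notin l & `|p - y| < e.
Proof.
(* One more candidate than [l] has entries; the shift to [k.+2] keeps even the first one at distance
   strictly below e. *)
move=> e0; pose q (k : nat) := p + e / k.+2%:R.
have qinj : injective q.
  move=> i j /addrI /(mulfI (lt0r_neq0 e0)) /invr_inj /eqP.
  by rewrite eqr_nat => /eqP[].
have [/allP lq|/allPn[_ /mapP[k _ ->] kl]] := boolP (all (mem l) [seq q k | k <- iota 0 (size l).+1]).
  have : uniq [seq q k | k <- iota 0 (size l).+1] by rewrite map_inj_uniq ?iota_uniq.
  by move/uniq_leq_size/(_ lq); rewrite size_map size_iota ltnn.
exists (q k) => //; rewrite opprD addNKr normrN gtr0_norm ?divr_gt0//.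
by rewrite ltr_pdivrMr// ltr_pMr// ltr1n.
Qed.

(** The factor 4 makes room for the bumps of [step_function], supported within 2 tau of each
    height. *)
Lemma separated_heights (m : nat) (s : 'I_m -> R) : injective s ->
  exists2 tau : R, 0 < tau & forall i j, i <> j -> 4 * tau <= `|s i - s j|.
Proof.
move=> sinj.
(* The value 1 on the diagonal keeps the minimum over all pairs positive. *)
pose f (p : 'I_m * 'I_m) := if p.1 == p.2 then 1 else `|s p.1 - s p.2|.
have f0 p : 0 < f p.
  rewrite /f; case: ifPn => // p12; rewrite normr_gt0 subr_eq0.
  by apply: contra p12 => /eqP /sinj ->.
exists (\big[Num.min/1]_p f p / 4).
  rewrite divr_gt0//; elim/big_ind: _ => // x y x0 y0.
  by rewrite lt_min x0 y0.
move=> i j /eqP ij; rewrite mulrC divfK ?pnatr_eq0//.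
have := bigmin_le 1 (i, j) f.
by rewrite {2}/f /= (negPf ij); apply.
Qed.

(** Meant for K = f'^-1 (im g'): once f' is precomposed with [Phi], contacts with g' are confined to
    times near the s i, each time determining its cell. *)
Lemma separate_balls (m : nat) (B : 'I_m -> set (R * R))
    (h : 'I_m -> R * R -> R * R) (K : set (R * R)) :
  (forall i, B i `<=` square /\ homeomorphism_on disk (B i) (h i)) ->
  (forall i j, i <> j -> B i `&` B j = set0) ->
  closed K -> K `<=` \bigcup_i (h i @` open_disk) ->
  exists (Phi : R * R -> R * R) (s : 'I_m -> R) (tau : R),
  [/\ {within square, continuous Phi} /\ (forall z, square z -> square (Phi z)),
      forall z, Phi z = z \/ exists2 i, B i z & B i (Phi z),
      0 < tau /\ (forall i j, i <> j -> 4 * tau <= `|s i - s j|) &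
      forall z, K (Phi z) -> exists2 i, B i (Phi z) & `|z.2 - s i| < tau].
Proof.
move=> HB disj cK HK.
have Bunique i j z : B i z -> B j z -> i = j.
  move=> iz jz; apply: contrapT => ij.
  by have : (B i `&` B j) z by []; rewrite disj.
have hB i : h i @` disk = B i by have [] := homeomorphism_on_image (HB i).2.
have hoB i : h i @` open_disk `<=` B i.
  by rewrite -hB => _ [x xD <-]; exists x => //; exact: open_disk_sub.
have ho i : open (h i @` open_disk).
  have [_ hinj _ _] := homeomorphism_on_image (HB i).2.
  by apply: invariance_of_domain => //; case: (HB i).2.
have clB i : closed (B i).
  by have [] := homeomorphism_on_image (HB i).2.
(* The interior of a cell is open, so it has points at infinitely many heights, and different cells
   can be given different ones. *)
have [s sinj Hs] : exists2 s : 'I_m -> R, injective s &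
    forall i, (fun y => exists2 c, open_disk c & (h i c).2 = y) (s i).
  apply: (@distinct_representatives _ _
    (fun i y => exists2 c, open_disk c & (h i c).2 = y)) => i l.
  have o0 : open_disk ((0 : R), (0 : R)).
    by change (0 ^+ 2 + 0 ^+ 2 < 1 :> R); rewrite expr0n addr0 ltr01.
  have : nbhs (h i (0, 0)) (h i @` open_disk).
    by apply: open_nbhs_nbhs; split; [exact: ho|exists (0, 0)].
  move=> /nbhs_ballP[e /= e0 He].
  have : exists2 y, y \notin l & `|(h i (0, 0)).2 - y| < e.
    exact: ball_avoids_seq.
  move=> [y yl ye]; exists y => //.
  have /He [c cD hc] : ball (h i (0, 0)) e ((h i (0,0)).1, y).
    by split => //; exact: ballxx.
  by exists c => //; rewrite hc.
have [tau tau0 Htau] := separated_heights sinj.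
have /choice[phi Hphi] : forall i, exists phi : R * R -> R * R,
  [/\ {within B i, continuous phi},
      forall z, B i z -> B i (phi z),
      forall z, B i z -> ~ (h i @` open_disk) z -> phi z = z &
      forall z, B i z -> K (phi z) -> `|z.2 - s i| < tau].
  move=> i; have [c cD <-] := Hs i.
  apply: ball_collapse => //; first exact: (HB i).2.
  (* The point lies in the interior of some cell; disjointness makes it the i-th one, and
     injectivity of [h i] makes its parameter interior. *)
  move=> x xD xK; have [j _ [y yD hyx]] := HK _ xK.
  have ij : i = j by apply: (Bunique _ _ (h i x)); [rewrite -hB; exists x|apply: hoB; exists y].
  subst j; have [_ hinj _ _] := homeomorphism_on_image (HB i).2.
  have <- // : y = x by apply: hinj hyx; rewrite inE//; exact: open_disk_sub.
pose Phi z := if [pick i | `[< B i z >]] is Some i then phi i z else z.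
have PhiB i z : B i z -> Phi z = phi i z.
  move=> iz; rewrite /Phi; case: pickP => [j /asboolP jz|/(_ i)].
    by rewrite (Bunique _ _ _ iz jz).
  by move/asboolP.
have PhiN z : (forall i, ~ B i z) -> Phi z = z.
  by move=> nz; rewrite /Phi; case: pickP => [j /asboolP /nz|].
have Phio z : (forall i, ~ (h i @` open_disk) z) -> Phi z = z.
  move=> nz; have [[i iz]|nB] := pselect (exists i, B i z).
    by rewrite (PhiB i)//; case: (Hphi i) => _ _ H _; exact: H.
  by apply: PhiN => i iz; apply: nB; exists i.
have PhiD z : Phi z = z \/ exists2 i, B i z & B i (Phi z).
  have [[i iz]|nB] := pselect (exists i, B i z); last first.
    by left; apply: PhiN => i iz; apply: nB; exists i.
  right; exists i => //; rewrite (PhiB i)//.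
  by case: (Hphi i) => _ H _ _; exact: H.
have cPhi : {within \bigcup_i B i, continuous Phi}.
  apply: within_bigcup_closed => // i; have [ci _ _ _] := Hphi i.
  by apply: within_ext ci => z iz; rewrite (PhiB i).
exists Phi, s, tau; split => //.
- split; last by move=> z sz; case: (PhiD z) => [->//|[i _ /((HB i).1)]].
  (* [Phi] is the identity off the interiors, boundary circles included; that first piece is closed
     by invariance of domain. *)
  have -> : square = (square `\` \bigcup_i (h i @` open_disk)) `|` \bigcup_i B i.
    apply/seteqP; split => [z sz|z [[]//|[i _ /((HB i).1)]//]].
    have [[i _ iz]|nB] := pselect ((\bigcup_i (h i @` open_disk)) z); last by left.
    by right; exists i => //; exact: hoB iz.
  apply: withinU_continuous.
  + rewrite setDE; apply: closedI.
      by apply: compact_closed; [exact: norm_hausdorff|exact: square_compact].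
    by apply: open_closedC; apply: bigcup_open => i _; exact: ho.
  + by apply: closed_bigcup => //; exact: finite_finset.
  + apply: (@within_ext _ _ _ id); last exact: within_id.
    by move=> z [_ nz]; rewrite Phio// => i iz; apply: nz; exists i.
  + exact: cPhi.
(* [Phi] moves points only within their cell, so [Phi z] in [B i] forces z in [B i]. *)
- move=> z Kz; have [i _ /hoB iz] := HK _ Kz; exists i => //.
  have Biz : B i z.
    by case: (PhiD z) => [<-//|[j jz /(Bunique _ _ _ iz)->]].
  by case: (Hphi i) => _ _ _; apply => //; rewrite -(PhiB i).
Qed.

End PlanarBalls.

(** * Homotopies disjoint from a nearly constant one *)

Section DisjointFromConstant.
Context {R : realType} {X : metricType R}.
Implicit Types f g : R * R -> X.

Lemma within_closed_preimage (S T : topologicalType) (A : set S) (C : set T)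
    (f : S -> T) :
  closed A -> {within A, continuous f} -> closed C -> closed (A `&` f @^-1` C).
Proof.
move=> cA cf cC; have /continuous_closedP/(_ _ cC)/closed_subspaceP[V cV VA] := cf.
by rewrite setIC -VA; exact: closedI.
Qed.

(** [diam] is a supremum and dominates the distances only when they are bounded; inside the square,
    2 is a bound. *)
Lemma eucl_dist_le_diam (B : set (R * R)) (z w : R * R) :
  B `<=` square -> B z -> B w -> eucl_dist z w <= diam B.
Proof.
move=> BS Bz Bw; apply: ub_le_sup; last by exists z => //; exists w.
exists 2 => _ [[a b] /BS[/= + +] [[c d] /BS[/= + +] <-]].
rewrite !in_itv /= /eucl_dist /= => /andP[a0 a1] /andP[b0 b1] /andP[c0 c1] /andP[d0 d1].
rewrite -(@ler_pXn2r _ 2%N) ?nnegrE ?sqrtr_ge0// sqr_sqrtr ?addr_ge0 ?sqr_ge0//.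
have ac : (a - c) ^+ 2 <= 1 by rewrite -[X in X <= _]real_normK ?num_real// expr_le1// ler_norml; lra.
have bd : (b - d) ^+ 2 <= 1 by rewrite -[X in X <= _]real_normK ?num_real// expr_le1// ler_norml; lra.
lra.
Qed.

Lemma step_function (m : nat) (s T : 'I_m -> R) (tau : R) : 0 < tau ->
  (forall i j, i <> j -> 4 * tau <= `|s i - s j|) ->
  (forall i, `[0, 1]%classic (T i)) ->
  exists psi : R -> R,
  [/\ continuous psi, forall t, `[0, 1]%classic (psi t) &
      forall i t, `|t - s i| < tau -> psi t = T i].
Proof.
move=> tau0 Hs HT.
(* A trapezoid: 1 within tau of [s i], 0 beyond 2 tau. The clamp in [psi] keeps every value in
   [0, 1] without altering the T i. *)
pose bump i t : R := Num.max 0 (Num.min 1 (2 - `|t - s i| / tau)).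
pose psi t := Num.max 0 (Num.min 1 (\sum_i T i * bump i t)).
exists psi; split.
- have cw (q : R -> R) : {within setT, continuous q} -> continuous q.
    by move=> cq; apply/continuous_subspace_setT.
  apply: cw; apply: within_max; first exact: within_cst.
  apply: within_min; first exact: within_cst.
  have cb i : {within setT, continuous (fun t => T i * bump i t)}.
    apply: within_mul; first exact: within_cst.
    apply: within_max; first exact: within_cst.
    apply: within_min; first exact: within_cst.
    apply: within_add; first exact: within_cst.
    apply: within_opp; apply: within_mul; last exact: within_cst.
    apply: within_norm; apply: within_add; [exact: within_id|exact: within_cst].
  elim: (index_enum _) => [|i r IH].
    by apply: (@within_ext _ _ _ (fun=> 0)); [move=> t _; rewrite big_nil|exact: within_cst].
  apply: (@within_ext _ _ _ (fun t => T i * bump i t + \sum_(j <- r) T j * bump j t)).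
    by move=> t _; rewrite big_cons.
  exact: within_add.
- by move=> t; rewrite /= in_itv /= le_max lexx ge_max ler01 ge_min lexx.
- move=> i t ti.
  have E : \sum_i T i * bump i t = T i.
    rewrite (bigD1 i)//= big1 ?addr0.
      have -> : bump i t = 1; last by rewrite mulr1.
      have : `|t - s i| / tau < 1 by rewrite ltr_pdivrMr// mul1r.
      by move=> ?; rewrite /bump min_l ?max_r//; lra.
    move=> j /eqP ji; have -> : bump j t = 0; last by rewrite mulr0.
    have : 2 <= `|t - s j| / tau.
      rewrite ler_pdivlMr//; have := Hs _ _ ji.
      have := ler_distD t (s j) (s i); rewrite (distrC (s j) t); lra.
    by move=> ?; rewrite /bump min_r ?max_l//; lra.
  rewrite /psi E; have := HT i; rewrite /= in_itv /= => /andP[T0 T1].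
  by rewrite min_r// max_r.
Qed.

Lemma disjoint_from_constant f g (eps : R) : delta_FMP X ->
  path_homotopy f -> constant_homotopy g -> 0 < eps ->
  exists f' g',
    [/\ path_homotopy f', path_homotopy g',
        approximates eps f f', approximates eps g g' &
        forall t x y, `[0, 1]%classic t -> `[0, 1]%classic x ->
          `[0, 1]%classic y -> f' (x, t) <> g' (y, t)].
Proof.
move=> FMP cf [cg gcst] eps0.
have e20 : 0 < eps / 2 by rewrite divr_gt0.
(* In a cell of diameter below d, moving a point changes f by less than eps / 2, so precomposition
   with [Phi] stays within the tolerance. *)
have [d d0 Hd] := within_compact_unif (@square_compact R) cf e20.
have [f' [g' [cf' cg' ff' gg' [m [B [h [HB disj dB HK HT]]]]]]] :=
  FMP f g d cf (conj cg gcst) d0 _ e20.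
pose K := square `&` f' @^-1` (g' @` square).
have clS : closed (square : set (R * R)).
  by apply: compact_closed; [exact: norm_hausdorff|exact: square_compact].
have cK : closed K.
  apply: within_closed_preimage => //; apply: compact_closed.
    exact: metric_hausdorff.
  by apply: continuous_compact => //; exact: square_compact.
have [Phi [s [tau [[cPhi sPhi] PhiD [tau0 Hs] PhiK]]]] := separate_balls HB disj cK HK.
have /choice[T {}HT] : forall i, exists t, `[0, 1]%classic t /\
    forall y, `[0, 1]%classic y -> ~ (f' @` B i) (g' (y, t)).
  move=> i; apply: contrapT => nt; apply: (HT i); apply/seteqP; split.
    by move=> _ [[x t] [[_ t01] _] <-].
  move=> t t01; apply: contrapT => nsnd; apply: nt; exists t; split => // y y01 fB.
  by apply: nsnd; exists (y, t).
have [psi [cpsi psi01 psis]] := step_function tau0 Hs (fun i => (HT i).1).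
exists (fun z => f' (Phi z)), (fun z => g' (z.1, psi z.2)); split.
- exact: (within_comp cf').
- apply: (within_comp cg') => [|z [z1 z2]]; last by split => //; exact: psi01.
  apply: within_pair; first by apply: within_fst; exact: within_id.
  by apply: within_cont => //; apply: within_snd; exact: within_id.
- move=> z sz; rewrite [eps]splitr; apply: le_lt_trans (metric_triangle _ (f (Phi z)) _) _.
  apply: ltrD; last exact/ff'/sPhi.
  have : ball z d (Phi z).
    case: (PhiD z) => [->|[i iz iPhi]]; first exact: ballxx.
    have zPhi : eucl_dist z (Phi z) < d.
      by apply: le_lt_trans (dB i); apply: eucl_dist_le_diam => //; exact: (HB i).1.
    have [n1 n2] := normr_le_enorm (z.1 - (Phi z).1, z.2 - (Phi z).2).
    by split; [exact: le_lt_trans n1 zPhi|exact: le_lt_trans n2 zPhi].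
  by move=> /(Hd _ _ sz (sPhi _ sz)); rewrite ballEmdist.
- move=> [x t] [/= x01 t01].
  have i0 : `[0, 1]%classic (0 : R) by rewrite /= in_itv /= lexx ler01.
  rewrite gcst// -(gcst x (psi t)); last by split => //; exact: psi01.
  apply: lt_le_trans (gg' _ _) _; first by split => //; exact: psi01.
  by rewrite ler_pdivrMr// ler_pMr// ler1n.
(* A contact at time t puts Phi (x, t) in a cell [B i] with t near [s i]; then psi t = T i, a time
   at which g' misses f' (B i). *)
- move=> t x y t01 x01 y01 fg.
  have /PhiK[i iPhi its] : K (Phi (x, t)).
    split; first by apply: sPhi; split.
    by exists (y, psi t) => //; split => //; exact: psi01.
  have [_ /(_ y y01)] := HT i; apply.
  by rewrite -(psis i t its) -fg; exists (Phi (x, t)).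
Qed.

End DisjointFromConstant.

(** * Local contractibility and fillings *)

Section SmallHomotopies.
Context {R : realType} {X : metricType R}.

Lemma segment_closed (a b : R) : closed (`[a, b]%classic : set R).
Proof. exact: interval_closed. Qed.

Lemma rect_closed (a b c d : R) : closed (`[a, b]%classic `*` `[c, d]%classic : set (R * R)).
Proof.
by apply: compact_closed; [exact: norm_hausdorff|apply: compact_setX; exact: segment_compact].
Qed.

Lemma glue_x (a b e c d : R) (F G : R * R -> X) : a <= b -> b <= e ->
  {within `[a, b]%classic `*` `[c, d]%classic, continuous F} ->
  {within `[b, e]%classic `*` `[c, d]%classic, continuous G} ->
  (forall s, `[c, d]%classic s -> F (b, s) = G (b, s)) ->
  {within `[a, e]%classic `*` `[c, d]%classic,
    continuous (fun z => if z.1 <= b then F z else G z)}.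
Proof.
move=> ab be cF cG FG.
have -> : `[a, e]%classic `*` `[c, d]%classic =
    (`[a, b]%classic `*` `[c, d]%classic) `|` (`[b, e]%classic `*` `[c, d]%classic) :> set (R * R).
  apply/seteqP; split => [[x s] [/= xe sd]|[x s] [[/= xe sd]|[/= xe sd]]].
  - move: xe; rewrite in_itv /= => /andP[ax xe].
    by case: (lerP x b) => xb; [left|right]; split => //=; rewrite in_itv /= ?ax ?xb// ltW.
  - by split => //=; move: xe; rewrite !in_itv /= => /andP[-> /le_trans->].
  - by split => //=; move: xe; rewrite !in_itv /= => /andP[/(le_trans ab)-> ->].
apply: within_glue => //; try exact: rect_closed.
- by move=> [x s] [/= + _]; rewrite in_itv /= => /andP[].
- move=> [x s] [/= + sd] [/= + _]; rewrite !in_itv /= => /andP[_ xb] /andP[bx _].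
  by have -> : x = b by [apply/eqP; rewrite eq_le xb]; exact: FG.
- move=> [x s] [/= + sd] /= xb; rewrite in_itv /= => /andP[bx _].
  by split => //=; rewrite in_itv /= xb (le_trans ab bx).
Qed.

Lemma glue_t (a b e c d : R) (F G : R * R -> X) : a <= b -> b <= e ->
  {within `[c, d]%classic `*` `[a, b]%classic, continuous F} ->
  {within `[c, d]%classic `*` `[b, e]%classic, continuous G} ->
  (forall s, `[c, d]%classic s -> F (s, b) = G (s, b)) ->
  {within `[c, d]%classic `*` `[a, e]%classic,
    continuous (fun z => if z.2 <= b then F z else G z)}.
Proof.
move=> ab be cF cG FG.
have cs (A : set (R * R)) : {within A, continuous (fun z : R * R => (z.2, z.1))}.
  by apply: within_pair; [apply: within_snd|apply: within_fst]; exact: within_id.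
pose F' z := F (z.2, z.1); pose G' z := G (z.2, z.1).
have cF' : {within `[a, b]%classic `*` `[c, d]%classic, continuous F'}.
  by apply: (within_comp cF (cs _)) => -[x t] [].
have cG' : {within `[b, e]%classic `*` `[c, d]%classic, continuous G'}.
  by apply: (within_comp cG (cs _)) => -[x t] [].
have := glue_x ab be cF' cG' FG.
move=> /within_comp /(_ (cs (`[c, d]%classic `*` `[a, e]%classic))) H.
by apply: (within_ext _ (H _)) => [[x t]|[x t] []].
Qed.

Definition contracts_in (V U : set X) :=
  exists (H : X * R -> X) (y : X),
    [/\ {within V `*` `[0, 1]%classic, continuous H},
        forall v, V v -> H (v, 0) = v,
        forall v, V v -> H (v, 1) = y &
        forall v t, V v -> `[0, 1]%classic t -> U (H (v, t))].

Lemma contracts_in_sub (V V' U U' : set X) : V' `<=` V -> U `<=` U' ->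
  contracts_in V U -> contracts_in V' U'.
Proof.
move=> VV UU [H [y [cH H0 H1 HU]]]; exists H, y; split => //.
- by apply: continuous_subspaceW cH => -[v t] [/VV].
- by move=> v /VV/H0.
- by move=> v /VV/H1.
- by move=> v t /VV Vv t01; exact/UU/HU.
Qed.

Lemma contracts_in_subset (V U : set X) : contracts_in V U -> V `<=` U.
Proof.
move=> [H [y [_ H0 _ HU]]] v Vv; rewrite -(H0 v)//; apply: HU => //.
by rewrite /= in_itv /= lexx ler01.
Qed.

(** As for a Lebesgue number: the contraction found at x serves the balls around all nearby x', half
    of each radius being spent on the displacement from x to x'. *)
Lemma uniformly_locally_contractible (K : set X) (eps : R) :
  @locally_contractible R X -> compact K -> 0 < eps ->
  exists2 lam : R, 0 < lam & forall p, K p -> contracts_in (ball p lam) (ball p eps).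
Proof.
move=> lcX /compact_near_coveringP cK e0.
have Hc : forall x, K x -> \forall x' \near x & d \near 0^'+,
    contracts_in (ball x' d) (ball x' eps).
  move=> x Kx; have e2 : 0 < eps / 2 by rewrite divr_gt0.
  have [V [nV VU] [H [y [cH H0 H1 HU]]]] := lcX x _ (nbhsx_ballx x _ e2).
  move/nbhs_ballP : nV => [r /= r0 Hr].
  exists (ball x (Num.min (r / 2) (eps / 2)), [set d | d < r / 2]) => /=.
    split; first by apply: nbhsx_ballx; rewrite lt_min !divr_gt0.
    by apply: nbhs_right_lt; rewrite divr_gt0.
  move=> [x' d] /= [xx' dr].
  have xr : ball x (r / 2) x' by apply: le_ball xx'; rewrite ge_min lexx.
  have xe : ball x (eps / 2) x' by apply: le_ball xx'; rewrite ge_min lexx orbT.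
  apply: (@contracts_in_sub V _ (ball x (eps / 2))).
  - move=> v vd; apply: Hr; rewrite [r]splitr; apply: ball_triangle xr _.
    by apply: le_ball vd; exact: ltW.
  - move=> v ve; rewrite [eps]splitr; apply: ball_triangle ve.
    exact: ball_sym.
  - by exists H, y; split => // v t Vv t01; apply: HU => //; rewrite inE.
have Hn := cK _ _ _ (@at_right_proper_filter R 0) Hc.
near (0:R)^'+ => d.
exists d; first by near: d; exact: nbhs_right_gt.
by move=> p Kp; apply: (near Hn d).
Unshelve. all: by end_near. Qed.

(** Both points are contracted to the same [y]: the track of a is followed by the reversed track of
    b. *)
Lemma path_in_contractible (V U : set X) (a b : X) : contracts_in V U -> V a -> V b ->
  exists gam : R -> X,
  [/\ {within `[0, 1]%classic, continuous gam}, gam 0 = a, gam 1 = b &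
      forall t, `[0, 1]%classic t -> U (gam t)].
Proof.
move=> [H [y [cH H0 H1 HU]]] Va Vb.
have h0 : (0 : R) <= 2^-1 by rewrite invr_ge0.
have h1 : (2^-1 : R) <= 1 by rewrite invf_le1// ler1n.
exists (fun t => if t <= 2^-1 then H (a, 2 * t) else H (b, 2 - 2 * t)); split.
- have -> : `[0, 1]%classic = `[0, 2^-1]%classic `|` `[2^-1, 1]%classic :> set R.
    apply/seteqP; split => [t|t [|]]; rewrite /= !in_itv /= => /andP[? ?].
    - by case: (lerP t 2^-1) => ?; [left|right]; rewrite /= ?in_itv /=; lra.
    - lra.
    - lra.
  have c2 (A : set R) : {within A, continuous (fun t => 2 * t)}.
    by apply: within_mul; [exact: within_cst|exact: within_id].
  apply: within_glue; try exact: segment_closed.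
  + by move=> t; rewrite /= in_itv /= => /andP[].
  + move=> t; rewrite /= !in_itv /= => /andP[_ t1] /andP[t2 _].
    have -> : t = 2^-1 by apply/eqP; rewrite eq_le t1.
    by rewrite mulfV// [2 - 1]addrK !H1.
  + by move=> t; rewrite /= !in_itv /= => /andP[t1 t2] t3; rewrite t3 (le_trans h0).
  + apply: (within_comp cH).
      by apply: within_pair; [exact: within_cst|exact: c2].
    by move=> t; rewrite /= in_itv /= => /andP[? ?]; split => //=; rewrite in_itv /=; lra.
  + apply: (within_comp cH).
      apply: within_pair; first exact: within_cst.
      by apply: within_add; [exact: within_cst|apply: within_opp; exact: c2].
    by move=> t; rewrite /= in_itv /= => /andP[? ?]; split => //=; rewrite in_itv /=; lra.
- by rewrite h0 mulr0 H0.
- have -> : (1 <= 2^-1 :> R) = false by apply/negP => ?; lra.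
  by rewrite mulr1 subrr H0.
- move=> t; rewrite /= in_itv /= => /andP[? ?]; case: ifPn => [?|]; last rewrite -ltNge => ?.
    by apply: HU => //; rewrite /= in_itv /=; lra.
  by apply: HU => //; rewrite /= in_itv /=; lra.
Qed.

(** The sup-norm distance of [z] to the centre of the unit square, scaled so
    that the boundary is [{sqdist = 1}]. *)
Definition sqdist (z : R * R) := Num.max `|2 * z.1 - 1| `|2 * z.2 - 1|.

Lemma squareE z : square z <-> sqdist z <= 1.
Proof.
case: z => x t; rewrite /square /sqdist /= ge_max !ler_norml.
split => [[/= + +]|/andP[/andP[? ?] /andP[? ?]]].
  rewrite !in_itv /= => /andP[? ?] /andP[? ?].
  by apply/andP; split; apply/andP; split; lra.
by split; rewrite /= in_itv /=; apply/andP; split; lra.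
Qed.

(** A cone: the boundary value at the radial projection [p z] is contracted as z moves inwards. The
    inner half-size square goes to [y], away from the singularity of the projection at the
    centre. *)
Lemma fill_square (V U : set X) (bd : R * R -> X) : contracts_in V U ->
  {within [set z | sqdist z = 1], continuous bd} ->
  (forall z, sqdist z = 1 -> V (bd z)) ->
  exists F : R * R -> X,
  [/\ {within square, continuous F}, forall z, sqdist z = 1 -> F z = bd z &
      forall z, square z -> U (F z)].
Proof.
move=> [H [y [cH H0 H1 HU]]] cbd Vbd.
have cn (A : set (R * R)) : {within A, continuous sqdist}.
  apply: within_max; apply: within_norm; apply: within_add; try exact: within_cst;
    apply: within_mul; try exact: within_cst.
    by apply: within_fst; exact: within_id.
  by apply: within_snd; exact: within_id.
have cn' : continuous sqdist by apply/continuous_subspace_setT; exact: cn.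
pose p (z : R * R) := (2^-1 + (z.1 - 2^-1) * (sqdist z)^-1,
                       2^-1 + (z.2 - 2^-1) * (sqdist z)^-1).
have np z : 0 < sqdist z -> sqdist (p z) = 1.
  move=> n0; have i0 : 0 <= (sqdist z)^-1 by rewrite invr_ge0 ltW.
  have E (u : R) : 2 * (2^-1 + (u - 2^-1) * (sqdist z)^-1) - 1 = (2 * u - 1) * (sqdist z)^-1.
    by field; exact: lt0r_neq0.
  rewrite {1}/sqdist /= !E !normrM (ger0_norm i0) -maxr_pMl//.
  by rewrite -/(sqdist z) mulfV// lt0r_neq0.
pose A := [set z | 2^-1 <= sqdist z <= 1].
pose B := [set z | sqdist z <= 2^-1].
have sAB : square = A `|` B.
  apply/seteqP; split => z.
    move=> /squareE z1; case: (lerP 2^-1 (sqdist z)) => z2; [left|right].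
      by apply/andP.
    exact: ltW.
  move=> H'; apply/squareE; case: H' => [/andP[]//|z1].
  by apply: le_trans z1 _; rewrite invf_le1// ler1n.
have A0 z : 2^-1 <= sqdist z -> 0 < sqdist z.
  by apply: lt_le_trans; rewrite invr_gt0.
exists (fun z => if 2^-1 <= sqdist z then H (bd (p z), 2 - 2 * sqdist z) else y); split.
- rewrite sAB; apply: within_glue.
  + have -> : A = sqdist @^-1` `[2^-1, 1]%classic.
      by apply/seteqP; split => z; rewrite /A /= in_itv.
    by apply: preimage_closed => //; exact: segment_closed.
  + have -> : B = sqdist @^-1` [set x | x <= 2^-1] by [].
    by apply: preimage_closed => //; exact: closed_le.
  + by move=> z /andP[].
  + move=> z /andP[z1 _] z2.
    have E : sqdist z = 2^-1 by apply/eqP; rewrite eq_le z1 z2.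
    rewrite E mulfV// [2 - 1]addrK H1//; apply: Vbd; apply: np.
    by rewrite E invr_gt0.
  + move=> z z1 z2; apply/andP; split => //.
    by apply: le_trans z1 _; rewrite invf_le1// ler1n.
  + apply: (within_comp cH); last first.
      move=> z /andP[z1 z2]; split; first by apply: Vbd; apply: np; exact: A0.
      by rewrite /= in_itv /=; lra.
    apply: within_pair; last first.
      apply: within_add; first exact: within_cst.
      by apply: within_opp; apply: within_mul; [exact: within_cst|exact: cn].
    apply: (within_comp cbd); last by move=> z /andP[z1 z2]; apply: np; exact: A0.
    have ci : {within A, continuous (fun z => (sqdist z)^-1)}.
      by apply: within_inv => // z /andP[z1 _]; apply: lt0r_neq0; exact: A0.
    apply: within_pair; (apply: within_add; first exact: within_cst);
      apply: within_mul => //; apply: within_add; try exact: within_cst.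
      by apply: within_fst; exact: within_id.
    by apply: within_snd; exact: within_id.
  + exact: within_cst.
- move=> z z1; have pz : p z = z.
    rewrite /p z1 invr1 !mulr1 ![2^-1 + _]addrC !subrK.
    by rewrite -surjective_pairing.
  rewrite z1 pz mulr1 subrr invf_le1// ler1n /=.
  by apply: H0; exact: Vbd.
- move=> z /squareE z1; case: ifPn => z2.
    apply: HU; first by apply: Vbd; apply: np; exact: A0.
    by rewrite /= in_itv /=; lra.
  (* A corner, as a sample boundary point whose contraction shows that y lies in U. *)
  have i0 : sqdist (0, 0) = 1.
    by rewrite /sqdist /= mulr0 sub0r normrN1 maxxx.
  rewrite -(H1 _ (Vbd _ i0)); apply: HU; first exact: Vbd.
  by rewrite /= in_itv /= ler01 lexx.
Qed.

End SmallHomotopies.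

(** * Joining nearby paths *)

Section JoiningPaths.
Context {R : realType} {X : metricType R}.
Implicit Types a b : R -> X.

Lemma sqdist_boundary (z : R * R) : sqdist z = 1 ->
  square z /\ [\/ z.1 = 0, z.1 = 1, z.2 = 0 | z.2 = 1].
Proof.
move=> z1; split; first by apply/squareE; rewrite z1.
have E (u : R) : `|2 * u - 1| = 1 -> u = 0 \/ u = 1.
  by move=> /eqP; rewrite eqr_norml => /andP[/orP[]/eqP ? _]; [right|left]; lra.
move: z1; rewrite /sqdist; case: leP => _ /E[] ?;
  by [constructor 1|constructor 2|constructor 3|constructor 4].
Qed.

Lemma square_boundary_continuous (bd : R * R -> X) :
  {within `[0, 1]%classic, continuous (fun s => bd (0, s))} ->
  {within `[0, 1]%classic, continuous (fun s => bd (1, s))} ->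
  {within `[0, 1]%classic, continuous (fun x => bd (x, 0))} ->
  {within `[0, 1]%classic, continuous (fun x => bd (x, 1))} ->
  {within [set z | sqdist z = 1], continuous bd}.
Proof.
move=> c1 c2 c3 c4.
pose I := `[0, 1]%classic : set R.
have H1 (c : R) : {within I, continuous (fun s => bd (c, s))} ->
    {within [set c] `*` I, continuous bd}.
  move=> cc; have cs : {within [set c] `*` I, continuous (fun z => bd (c, z.2))}.
    apply: (within_comp cc) => [|z []//].
    by apply: within_snd; exact: within_id.
  by apply: within_ext cs => -[x s] [/= ->].
have H2 (c : R) : {within I, continuous (fun s => bd (s, c))} ->
    {within I `*` [set c], continuous bd}.
  move=> cc; have cs : {within I `*` [set c], continuous (fun z => bd (z.1, c))}.
    apply: (within_comp cc) => [|z []//].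
    by apply: within_fst; exact: within_id.
  by apply: within_ext cs => -[x s] [/= _ ->].
have cl1 (c : R) : closed ([set c] `*` I).
  by rewrite -set_itv1; exact: rect_closed.
have cl2 (c : R) : closed (I `*` [set c]).
  by rewrite -set_itv1; exact: rect_closed.
apply: (@continuous_subspaceW _ _ _
  ((([set 0] `*` I) `|` ([set 1] `*` I)) `|` ((I `*` [set 0]) `|` (I `*` [set 1])))).
  move=> [x s] /sqdist_boundary [[/= x01 s01]] [] /= ?.
  - by left; left.
  - by left; right.
  - by right; left.
  - by right; right.
apply: withinU_continuous; try by apply: closedU.
- by apply: withinU_continuous => //; exact: H1.
- by apply: withinU_continuous => //; exact: H2.
Qed.

Lemma itv01_affine (x0 x1 x : R) : x0 < x1 -> x0 <= x <= x1 ->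
  `[0, 1]%classic ((x - x0) / (x1 - x0)).
Proof.
move=> x01 /andP[xx0 xx1]; have d0 : 0 < x1 - x0 by rewrite subr_gt0.
rewrite /= in_itv /=; apply/andP; split.
  by rewrite divr_ge0 ?subr_ge0// ltW.
by rewrite ler_pdivrMr// mul1r lerD2r.
Qed.

(* The unit interval is cut into pieces so short that the boundary of each
   piece times [0, 1] can be mapped into a ball that contracts in a small ball. *)
Lemma small_homotopy (f : R * R -> X) (eps : R) :
  @locally_contractible R X -> path_homotopy f -> 0 < eps ->
  exists2 d : R, 0 < d & forall t a b, `[0, 1]%classic t ->
    {within `[0, 1]%classic, continuous a} -> {within `[0, 1]%classic, continuous b} ->
    (forall x, `[0, 1]%classic x -> mdist (f (x, t)) (a x) < d) ->
    (forall x, `[0, 1]%classic x -> mdist (f (x, t)) (b x) < d) ->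
    exists H : R * R -> X,
    [/\ path_homotopy H, forall x, `[0, 1]%classic x -> H (x, 0) = a x,
        forall x, `[0, 1]%classic x -> H (x, 1) = b x &
        forall z, square z -> mdist (f (z.1, t)) (H z) < eps].
Proof.
move=> lcX cf e0.
have cK : compact (f @` square) by apply: continuous_compact => //; exact: square_compact.
(* Two nested scales: boundaries in balls of radius [l1] are filled within eps / 2, and points in
   balls of radius [l2] are joined within l1 / 2. They come from the whole compact image of f, so
   the resulting d serves all t, a and b. *)
have e20 : 0 < eps / 2 by rewrite divr_gt0.
have [l1 l10 Hl1] := uniformly_locally_contractible lcX cK e20.
have l120 : 0 < l1 / 2 by rewrite divr_gt0.
have [l2 l20 Hl2] := uniformly_locally_contractible lcX cK l120.
have m0 : 0 < Num.min (l1 / 2) (eps / 2) by rewrite lt_min l120.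
have [e e'0 He] := within_compact_unif (@square_compact R) cf m0.
have [n n0 ne] : exists2 n : nat, (0 < n)%N & n%:R^-1 < e.
  have [n _ /(_ n (leqnn _)) H] := near_infty_natSinv_lt (PosNum e'0).
  by exists n.+1.
have nn0 : (0 : R) < n%:R by rewrite ltr0n.
exists (Num.min l2 (l1 / 2)); first by rewrite lt_min l20.
move=> t a b t01 ca cb fa fb.
pose x k : R := k%:R / n%:R.
have x01 k : (k <= n)%N -> `[0, 1]%classic (x k).
  move=> kn; rewrite /= in_itv /= divr_ge0 ?ler0n//=.
  by rewrite ler_pdivrMr// mul1r ler_nat.
have xS k : x k.+1 = x k + n%:R^-1 by rewrite /x -addn1 natrD mulrDl mul1r.
have xSlt k : x k < x k.+1 by rewrite xS ltrDl invr_gt0.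
have fK y : `[0, 1]%classic y -> (f @` square) (f (y, t)) by move=> y01; exists (y, t).
have fosc k y : (k < n)%N -> x k <= y <= x k.+1 ->
    [/\ `[0, 1]%classic y, mdist (f (x k, t)) (f (y, t)) < l1 / 2 & mdist (f (x k, t)) (f (y, t)) < eps / 2].
  move=> kn /andP[y1 y2].
  have y01 : `[0, 1]%classic y.
    have := x01 _ (ltnW kn); have := x01 _ kn; rewrite /= !in_itv /=; lra.
  have : ball (x k, t) e (y, t).
    split; last exact: ballxx.
    rewrite /ball /= distrC ger0_norm ?subr_ge0//; move: y2; rewrite xS; lra.
  have skt : square (x k, t) by split => //; exact/x01/ltnW.
  have syt : square (y, t) by split.
  move=> /(He _ _ skt syt); rewrite ballEmdist /= lt_min => /andP[].
  by split.
have side y : `[0, 1]%classic y -> exists gam : R -> X,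
    [/\ {within `[0, 1]%classic, continuous gam}, gam 0 = a y, gam 1 = b y &
      forall s, `[0, 1]%classic s -> mdist (f (y, t)) (gam s) < l1 / 2].
  move=> y01; have [||gam [cg g0 g1 gU]] := @path_in_contractible R X _ _ (a y) (b y) (Hl2 _ (fK _ y01)).
  - by rewrite ballEmdist /=; apply: lt_le_trans (fa _ y01) _; rewrite ge_min lexx.
  - by rewrite ballEmdist /=; apply: lt_le_trans (fb _ y01) _; rewrite ge_min lexx.
  by exists gam; split => // s s01; have := gU s s01; rewrite ballEmdist.
(* The last clause lets the right edge serve as the left edge of the next square. *)
have key k : (k <= n)%N -> exists H : R * R -> X,
    [/\ {within `[0, x k]%classic `*` `[0, 1]%classic, continuous H},
        forall y, 0 <= y <= x k -> H (y, 0) = a y /\ H (y, 1) = b y,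
        forall y s, 0 <= y <= x k -> `[0, 1]%classic s -> mdist (f (y, t)) (H (y, s)) < eps &
        forall s, `[0, 1]%classic s -> mdist (f (x k, t)) (H (x k, s)) < l1 / 2].
  have x0 : x 0%N = 0 by rewrite /x mul0r.
  elim: k => [|k IH] kn.
    have [gam [cg g0 g1 gU]] := side _ (x01 _ kn).
    have yx y : 0 <= y <= x 0%N -> y = x 0%N by rewrite x0 => ?; lra.
    exists (fun z => gam z.2); split.
    - apply: (within_comp cg) => [|z []//].
      by apply: within_snd; exact: within_id.
    - by move=> y /yx ->.
    - move=> y s /yx -> /gU g.
      have : ball (f (x 0%N, t)) l1 (gam s).
        rewrite ballEmdist /=; apply: lt_le_trans g _.
        by rewrite ler_pdivrMr// ler_pMr// ler1n.
      move=> /(contracts_in_subset (Hl1 _ (fK _ (x01 _ kn)))).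
      rewrite ballEmdist /= => /lt_le_trans; apply.
      by rewrite ler_pdivrMr// ler_pMr// ler1n.
    - by move=> s /gU.
  have [H [cH Hab Hf Hk]] := IH (ltnW kn).
  have [gam [cg g0 g1 gU]] := side _ (x01 _ kn).
  have d0 : 0 < x k.+1 - x k by rewrite subr_gt0.
  have xk0 : 0 <= x k by rewrite divr_ge0 ?ler0n.
  have xkk : 0 <= x k <= x k by rewrite xk0 lexx.
  pose y u := x k + u * (x k.+1 - x k).
  have yI u : `[0, 1]%classic u -> x k <= y u <= x k.+1.
    rewrite /= in_itv /= => /andP[u0 u1]; rewrite /y lerDl mulr_ge0 ?(ltW d0)//=.
    by rewrite -lerBrDl ler_piMl// ltW.
  have y0 : y 0 = x k by rewrite /y mul0r addr0.
  have y1 : y 1 = x k.+1 by rewrite /y mul1r addrC subrK.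
  (* Corners are read off the vertical sides, whose endpoints are the values of a and b there. *)
  pose bd (z : R * R) := if z.1 == 0 then H (x k, z.2) else if z.1 == 1 then gam z.2
    else if z.2 == 0 then a (y z.1) else b (y z.1).
  have bd0 s : bd (0, s) = H (x k, s) by rewrite /bd eqxx.
  have bd1 s : bd (1, s) = gam s by rewrite /bd oner_eq0 eqxx.
  have bda u : bd (u, 0) = a (y u).
    rewrite /bd /=; case: eqP => [->|_]; first by rewrite y0; case: (Hab _ xkk).
    by case: eqP => [->|_]; rewrite ?y1// eqxx.
  have bdb u : bd (u, 1) = b (y u).
    rewrite /bd /=; case: eqP => [->|_]; first by rewrite y0; case: (Hab _ xkk).
    by case: eqP => [->|_]; rewrite ?y1// oner_eq0.
  have cy : {within `[0, 1]%classic, continuous y}.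
    apply: within_add; first exact: within_cst.
    by apply: within_mul; [exact: within_id|exact: within_cst].
  have yI01 u : `[0, 1]%classic u -> `[0, 1]%classic (y u).
    by move=> /yI /(fosc _ _ kn)[].
  have cbd : {within [set z | sqdist z = 1], continuous bd}.
    apply: square_boundary_continuous.
    - apply: (@within_ext _ _ _ (fun s => H (x k, s))) => [s _|]; first by rewrite bd0.
      apply: (within_comp cH); first by apply: within_pair; [exact: within_cst|exact: within_id].
      by move=> s s01; split => //=; rewrite in_itv.
    - by apply: within_ext cg => s _; rewrite bd1.
    - apply: (@within_ext _ _ _ (fun s => a (y s))) => [s _|]; first by rewrite bda.
      exact: (within_comp ca).
    - apply: (@within_ext _ _ _ (fun s => b (y s))) => [s _|]; first by rewrite bdb.
      exact: (within_comp cb).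
  have xk01 := x01 _ (ltnW kn).
  have [F [cF Fbd FU]] : exists F : R * R -> X,
      [/\ {within square, continuous F}, forall z, sqdist z = 1 -> F z = bd z &
      forall z, square z -> ball (f (x k, t)) (eps / 2) (F z)].
    apply: (fill_square (Hl1 _ (fK _ xk01))) => //.
    move=> [u s] /sqdist_boundary[[/= u01 s01]].
    have [yu01 yul _] := fosc _ _ kn (yI _ u01).
    have near_ab c : mdist (f (y u, t)) c < Num.min l2 (l1 / 2) -> ball (f (x k, t)) l1 c.
      rewrite ballEmdist /= lt_min => /andP[_ ?].
      by rewrite [l1]splitr; apply: le_lt_trans (metric_triangle _ (f (y u, t)) _) _; apply: ltrD.
    case => /= ->.
    - rewrite bd0 ballEmdist /=; apply: lt_le_trans (Hk _ s01) _.
      by rewrite ler_pdivrMr// ler_pMr// ler1n.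
    - rewrite bd1 ballEmdist /= [l1]splitr.
      have [|_ xl _] := fosc _ (x k.+1) kn; first by rewrite lexx ltW.
      by apply: le_lt_trans (metric_triangle _ (f (x k.+1, t)) _) _; apply: ltrD => //; exact: gU.
    - by rewrite bda; apply/near_ab/fa.
    - by rewrite bdb; apply/near_ab/fb.
  have bdE (u s : R) : `[0, 1]%classic u -> `[0, 1]%classic s ->
      [\/ u = 0, u = 1, s = 0 | s = 1] -> F (u, s) = bd (u, s).
    move=> u01 s01 us; apply: Fbd; rewrite /sqdist /=.
    have u1 : `|2 * u - 1| <= 1 by move: u01; rewrite /= in_itv /= ler_norml; lra.
    have s1 : `|2 * s - 1| <= 1 by move: s01; rewrite /= in_itv /= ler_norml; lra.
    have n0' : `|2 * 0 - 1 : R| = 1 by rewrite mulr0 sub0r normrN1.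
    have n1' : `|2 * 1 - 1 : R| = 1 by rewrite mulr1 addrK normr1.
    case: us => E; move: u1 s1; rewrite E ?n0' ?n1' => u1 s1; by [rewrite max_l|rewrite max_r].
  have i0 : `[0, 1]%classic (0 : R) by rewrite /= in_itv /= lexx ler01.
  have i1 : `[0, 1]%classic (1 : R) by rewrite /= in_itv /= lexx ler01.
  pose u v := (v - x k) / (x k.+1 - x k).
  have u01 v : x k <= v <= x k.+1 -> `[0, 1]%classic (u v) by exact: itv01_affine.
  have yu v : y (u v) = v by rewrite /y /u divfK ?gt_eqF// addrC subrK.
  have u0 : u (x k) = 0 by rewrite /u subrr mul0r.
  have u1 : u (x k.+1) = 1 by rewrite /u mulfV ?gt_eqF.
  exists (fun z => if z.1 <= x k then H z else F (u z.1, z.2)); split.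
  - apply: glue_x => //; first exact: ltW.
    + apply: (within_comp cF); last first.
        move=> [v s] [/= vk s01]; split => //=; apply: u01.
        by move: vk; rewrite in_itv.
      apply: within_pair; last by apply: within_snd; exact: within_id.
      apply: within_mul; last exact: within_cst.
      by apply: within_add; [apply: within_fst; exact: within_id|exact: within_cst].
    + by move=> s s01; rewrite /= u0 bdE ?bd0//; constructor.
  - move=> v /andP[v0 vk] /=; case: (lerP v (x k)) => vx.
      by apply: Hab; rewrite v0.
    have vI : x k <= v <= x k.+1 by rewrite vk ltW.
    rewrite !bdE//; [by rewrite bda bdb yu|exact: u01|by constructor 4|exact: u01|by constructor 3].
  - move=> v s /andP[v0 vk] s01 /=; case: (lerP v (x k)) => vx.
      by apply: Hf; rewrite ?v0.
    have vI : x k <= v <= x k.+1 by rewrite vk ltW.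
    have [_ _ vl] := fosc _ _ kn vI.
    have suv : square (u v, s) by split => //; exact: u01.
    have := FU _ suv; rewrite ballEmdist /= => FUv.
    rewrite [eps]splitr; apply: le_lt_trans (metric_triangle _ (f (x k, t)) _) _.
    by rewrite metric_sym; apply: ltrD => //; rewrite metric_sym.
  - move=> s s01 /=; rewrite leNgt xSlt /= u1 bdE ?bd1//; first exact: gU.
    by constructor.
have xn : x n = 1 by rewrite /x mulfV// gt_eqF.
have [H [cH Hab Hf _]] := key _ (leqnn n).
rewrite xn in cH Hab Hf.
exists H; split => //.
- by move=> y; rewrite /= in_itv /= => /Hab[].
- by move=> y; rewrite /= in_itv /= => /Hab[].
- by move=> [y s] [/= + s01]; rewrite in_itv /= => y01; exact: Hf.
Qed.

End JoiningPaths.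

(** * Concatenation of disjoint homotopies *)

Section Tracks.
Context {R : realType} {X : metricType R}.
Implicit Types a b c p q : R -> X.

Lemma within_mdist (S : topologicalType) (A : set S) (f g : S -> X) :
  {within A, continuous f} -> {within A, continuous g} ->
  {within A, continuous (fun x => mdist (f x) (g x))}.
Proof.
move=> /subspace_continuousP cf /subspace_continuousP cg.
apply/subspace_continuousP => x Ax; apply/cvgrPdist_lt => e e0.
have e20 : 0 < e / 2 by rewrite divr_gt0.
have Hf : \forall y \near x, A y -> ball (f x) (e / 2) (f y).
  exact: cf Ax _ (nbhsx_ballx (f x) _ e20).
have Hg : \forall y \near x, A y -> ball (g x) (e / 2) (g y).
  exact: cg Ax _ (nbhsx_ballx (g x) _ e20).
have : \forall y \near x, A y -> `|mdist (f x) (g x) - mdist (f y) (g y)| < e.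
  near=> y => Ay.
  have : ball (f x) (e / 2) (f y) by apply: (near Hf y).
  have : ball (g x) (e / 2) (g y) by apply: (near Hg y).
  rewrite !ballEmdist /= => gy fy.
  have := metric_triangle (f x) (f y) (g x); have := metric_triangle (f y) (g y) (g x).
  have := metric_triangle (f y) (f x) (g y); have := metric_triangle (f x) (g x) (g y).
  rewrite (metric_sym (g y) (g x)) (metric_sym (f y) (f x)) => ? ? ? ?.
  rewrite ltr_norml; lra.
by [].
Unshelve. all: by end_near. Qed.

Definition disjoint_paths a b :=
  forall x y : R, `[0, 1]%classic x -> `[0, 1]%classic y -> a x <> b y.

Definition close_paths (e : R) a b :=
  forall x : R, `[0, 1]%classic x -> mdist (a x) (b x) < e.

(** The references p and q are fixed paths: on a short time interval single slices of f and g stand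
    for the homotopies, and tracks with the same references can be concatenated. *)
Definition track (e : R) p q a b a' b' :=
  exists F G : R * R -> X,
  [/\ path_homotopy F /\ path_homotopy G,
      forall x, `[0, 1]%classic x -> F (x, 0) = a x /\ F (x, 1) = a' x,
      forall x, `[0, 1]%classic x -> G (x, 0) = b x /\ G (x, 1) = b' x,
      forall t, `[0, 1]%classic t ->
        close_paths e p (fun x => F (x, t)) /\ close_paths e q (fun x => G (x, t)) &
      forall t, `[0, 1]%classic t ->
        disjoint_paths (fun x => F (x, t)) (fun x => G (x, t))].

Lemma track_sym e p q a b a' b' : track e p q a b a' b' -> track e q p b a b' a'.
Proof.
move=> [F [G [[cF cG] Fe Ge FGe FG]]]; exists G, F; split => //.
- by move=> t /FGe[].
- by move=> t t01 x y x01 y01 /esym; exact: FG.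
Qed.

Lemma track_trans e p q a b a' b' a'' b'' :
  track e p q a b a' b' -> track e p q a' b' a'' b'' -> track e p q a b a'' b''.
Proof.
move=> [F [G [[cF cG] Fe Ge FGe FG]]] [F' [G' [[cF' cG'] Fe' Ge' FGe' FG']]].
have h0 : (0 : R) <= 2^-1 by rewrite invr_ge0.
have h1 : (2^-1 : R) <= 1 by rewrite invf_le1// ler1n.
have h10 : (1 <= 2^-1 :> R) = false by apply/negP => ?; lra.
pose j (u v : R * R -> X) (z : R * R) :=
  if z.2 <= 2^-1 then u (z.1, 2 * z.2) else v (z.1, 2 * z.2 - 1).
have cj u v : path_homotopy u -> path_homotopy v ->
    (forall x, `[0, 1]%classic x -> u (x, 1) = v (x, 0)) -> path_homotopy (j u v).
  move=> cu cv uv; have c2 (A : set (R * R)) : {within A, continuous (fun z : R * R => 2 * z.2)}.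
    by apply: within_mul; [exact: within_cst|apply: within_snd; exact: within_id].
  apply: glue_t => //.
  - apply: (within_comp cu).
      by apply: within_pair; [apply: within_fst; exact: within_id|exact: c2].
    move=> [x t] [/= x01]; rewrite in_itv /= => /andP[t0 t1].
    by split => //=; rewrite in_itv /=; lra.
  - apply: (within_comp cv).
      apply: within_pair; first by apply: within_fst; exact: within_id.
      by apply: within_add; [exact: c2|exact: within_cst].
    move=> [x t] [/= x01]; rewrite in_itv /= => /andP[t0 t1].
    by split => //=; rewrite in_itv /=; lra.
  - by move=> x x01 /=; rewrite mulfV// subrr; exact: uv.
have j0 u v x : j u v (x, 0) = u (x, 0) by rewrite /j /= h0 mulr0.
have j1 u v x : j u v (x, 1) = v (x, 1) by rewrite /j /= h10 mulr1 addrK.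
have jt t : `[0, 1]%classic t ->
    (exists2 s, `[0, 1]%classic s & forall u v x, j u v (x, t) = u (x, s)) \/
    (exists2 s, `[0, 1]%classic s & forall u v x, j u v (x, t) = v (x, s)).
  rewrite /= in_itv /= => /andP[t0 t1]; case: (lerP t 2^-1) => th; [left|right].
    by exists (2 * t) => [|u v x]; [rewrite /= in_itv /=; lra|rewrite /j /= th].
  exists (2 * t - 1) => [|u v x]; first by rewrite /= in_itv /=; lra.
  by rewrite /j /= leNgt th.
exists (j F F'), (j G G'); split.
- split; apply: cj => // x x01.
    by rewrite (Fe _ x01).2 (Fe' _ x01).1.
  by rewrite (Ge _ x01).2 (Ge' _ x01).1.
- by move=> x x01; rewrite j0 j1 (Fe _ x01).1 (Fe' _ x01).2.
- by move=> x x01; rewrite j0 j1 (Ge _ x01).1 (Ge' _ x01).2.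
- move=> t /jt[[s s01 E]|[s s01 E]]; split => x x01; rewrite E.
  + exact: (FGe _ s01).1.
  + exact: (FGe _ s01).2.
  + exact: (FGe' _ s01).1.
  + exact: (FGe' _ s01).2.
- move=> t /jt[[s s01 E]|[s s01 E]] x y x01 y01; rewrite !E.
  + exact: FG.
  + exact: FG'.
Qed.

Lemma disjoint_paths_dist a b :
  {within `[0, 1]%classic, continuous a} -> {within `[0, 1]%classic, continuous b} ->
  disjoint_paths a b -> exists2 theta : R, 0 < theta &
    forall x y : R, `[0, 1]%classic x -> `[0, 1]%classic y -> theta <= mdist (a x) (b y).
Proof.
move=> ca cb ab.
have cm : {within square, continuous (fun z : R * R => mdist (a z.1) (b z.2))}.
  apply: within_mdist.
    by apply: (within_comp ca) => [|z []//]; apply: within_fst; exact: within_id.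
  by apply: (within_comp cb) => [|z []//]; apply: within_snd; exact: within_id.
have [|z zS zmin] := compact_EVT_min _ (@square_compact R) cm.
  by exists (0, 0); split; rewrite /= in_itv /= lexx ler01.
move: zS; rewrite inE => -[z1 z2].
exists (mdist (a z.1) (b z.2)).
  by rewrite mdist_gt0; apply/eqP; exact: ab.
by move=> x y x01 y01; apply: (zmin (x, y)); rewrite inE.
Qed.

Lemma const_path_homotopy a : {within `[0, 1]%classic, continuous a} ->
  constant_homotopy (fun z : R * R => a z.1).
Proof.
move=> ca; split => //.
by apply: (within_comp ca) => [|z []//]; apply: within_fst; exact: within_id.
Qed.

Lemma path_homotopy_slice (F : R * R -> X) t : path_homotopy F ->
  `[0, 1]%classic t -> {within `[0, 1]%classic, continuous (fun x => F (x, t))}.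
Proof.
move=> cF t01; apply: (within_comp cF) => [|x x01]; last by split.
by apply: within_pair; [exact: within_id|exact: within_cst].
Qed.

Lemma itv01_0 : `[0, 1]%classic (0 : R).
Proof. by rewrite /= in_itv /= lexx ler01. Qed.

Lemma itv01_1 : `[0, 1]%classic (1 : R).
Proof. by rewrite /= in_itv /= lexx ler01. Qed.

(* The homotopies given by the fractured maps property do not start exactly at
   [a] and [b]; they start so close that the short homotopies leading to their
   initial paths remain disjoint. *)
Lemma move_first (e eta : R) p q a b (u : R * R -> X) :
  @locally_contractible R X -> delta_FMP X -> 0 < e -> 0 < eta ->
  {within `[0, 1]%classic, continuous b} -> path_homotopy u ->
  (forall x, `[0, 1]%classic x -> u (x, 0) = a x) ->
  disjoint_paths a b ->
  (forall t, `[0, 1]%classic t -> close_paths (e / 2) p (fun x => u (x, t))) ->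
  close_paths (e / 2) q b ->
  exists a' b',
  [/\ {within `[0, 1]%classic, continuous a'} /\ {within `[0, 1]%classic, continuous b'},
      disjoint_paths a' b', close_paths eta (fun x => u (x, 1)) a',
      close_paths eta b b' & track e p q a b a' b'].
Proof.
move=> X_lc X_FMP e0 eta0 cb cu u0 ab pu qb.
have ca : {within `[0, 1]%classic, continuous a}.
  by apply: within_ext (path_homotopy_slice cu itv01_0); exact: u0.
have [theta th0 Hth] := disjoint_paths_dist ca cb ab.
(* Half of theta for each connecting homotopy, so that together they cannot bridge the distance from
   a to b. *)
have m0 : 0 < Num.min (theta / 2) (e / 2) by rewrite lt_min !divr_gt0.
have [da da0 Ha] := small_homotopy X_lc (const_path_homotopy ca).1 m0.
have [db db0 Hb] := small_homotopy X_lc (const_path_homotopy cb).1 m0.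
pose k := Num.min (Num.min da db) (Num.min eta (e / 2)).
have k0 : 0 < k by rewrite !lt_min da0 db0 eta0 divr_gt0.
have kl r : r < k -> [/\ r < da, r < db, r < eta & r < e / 2].
  by rewrite !lt_min => /andP[/andP[? ?] /andP[? ?]].
have [u' [b' [cu' cb' uu' bb' ub']]] := disjoint_from_constant X_FMP cu (const_path_homotopy cb) k0.
have sq (x t : R) : `[0, 1]%classic x -> `[0, 1]%classic t -> square (x, t) by split.
have [i0 i1] := (itv01_0, itv01_1).
exists (fun x => u' (x, 1)), (fun x => b' (x, 1)); split.
- by split; exact: path_homotopy_slice.
- by move=> x y x01 y01; exact: ub'.
- by move=> x x01; have [] := kl _ (uu' _ (sq _ _ x01 i1)).
- by move=> x x01; have [] := kl _ (bb' _ (sq _ _ x01 i1)).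
apply: (@track_trans _ _ _ _ _ (fun x => u' (x, 0)) (fun x => b' (x, 0))).
- have [||F [cF F0 F1 Fa]] := Ha 0 a (fun x => u' (x, 0)) i0 ca (path_homotopy_slice cu' i0).
  + by move=> x _; rewrite mdistxx.
  + by move=> x x01; rewrite /= -u0//; have [] := kl _ (uu' _ (sq _ _ x01 i0)).
  have [||G [cG G0 G1 Gb]] := Hb 0 b (fun x => b' (x, 0)) i0 cb (path_homotopy_slice cb' i0).
  + by move=> x _; rewrite mdistxx.
  + by move=> x x01; have [] := kl _ (bb' _ (sq _ _ x01 i0)).
  exists F, G; split => //.
  + by move=> x x01; rewrite F0 ?F1.
  + by move=> x x01; rewrite G0 ?G1.
  + move=> t t01; split => x x01; rewrite [e]splitr.
      apply: le_lt_trans (metric_triangle _ (a x) _) _; apply: ltrD.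
        by rewrite -u0//; exact: pu.
      by have := Fa _ (sq _ _ x01 t01); rewrite lt_min => /andP[].
    apply: le_lt_trans (metric_triangle _ (b x) _) _; apply: ltrD; first exact: qb.
    by have := Gb _ (sq _ _ x01 t01); rewrite lt_min => /andP[].
  + move=> t t01 x y x01 y01 FG; have := Hth x y x01 y01.
    rewrite leNgt => /negP; apply; rewrite [theta]splitr.
    apply: le_lt_trans (metric_triangle _ (F (x, t)) _) _; apply: ltrD.
      by have := Fa _ (sq _ _ x01 t01); rewrite lt_min => /andP[].
    rewrite FG metric_sym.
    by have := Gb _ (sq _ _ y01 t01); rewrite lt_min => /andP[].
- exists u', b'; split => //.
  + move=> t t01; split => x x01; rewrite [e]splitr.
      apply: le_lt_trans (metric_triangle _ (u (x, t)) _) _; apply: ltrD; first exact: pu.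
      by have [] := kl _ (uu' _ (sq _ _ x01 t01)).
    apply: le_lt_trans (metric_triangle _ (b x) _) _; apply: ltrD; first exact: qb.
    by have [] := kl _ (bb' _ (sq _ _ x01 t01)).
  + by move=> t t01 x y x01 y01; exact: ub'.
Qed.

Lemma close_trans (e1 e2 : R) a b c : close_paths e1 a b -> close_paths e2 b c ->
  close_paths (e1 + e2) a c.
Proof.
move=> ab bc x x01; apply: le_lt_trans (metric_triangle _ (b x) _) _.
by apply: ltrD; [exact: ab|exact: bc].
Qed.

Lemma close_le (e1 e2 : R) a b : e1 <= e2 -> close_paths e1 a b -> close_paths e2 a b.
Proof. by move=> e12 ab x x01; apply: lt_le_trans (ab x x01) e12. Qed.

Lemma locally_contractible_FMP_DHP :
  @locally_contractible R X -> delta_FMP X -> DHP X.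
Proof.
move=> X_lc X_FMP f g cf cg eps eps0.
have e20 : 0 < eps / 2 by rewrite divr_gt0.
have e40 : 0 < eps / 2 / 2 by rewrite divr_gt0.
have [df df0 Hf] := small_homotopy X_lc cf e40.
have [dg dg0 Hg] := small_homotopy X_lc cg e40.
(* Room for 2 sg: a path within sg of its slice has drifted by a further sg / 2 when its own turn to
   move comes. *)
have [sg sg0 [sf1 sg1 se1]] : exists2 s : R, 0 < s &
    [/\ s + s <= df, s + s <= dg & s + s <= eps / 2 / 2].
  exists (Num.min (Num.min df dg) (eps / 2 / 2) / 2).
    by rewrite divr_gt0// !lt_min df0 dg0.
  by rewrite -splitr !ge_min !lexx !orbT.
have [d1 d10 Hd1] := within_compact_unif (@square_compact R) cf sg0.
have [d2 d20 Hd2] := within_compact_unif (@square_compact R) cg sg0.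
have m0 : 0 < Num.min d1 d2 by rewrite lt_min d10.
have [n n0 nd] : exists2 n : nat, (0 < n)%N & n%:R^-1 < Num.min d1 d2.
  have [n _ /(_ n (leqnn _)) H] := near_infty_natSinv_lt (PosNum m0).
  by exists n.+1.
have nn0 : (0 : R) < n%:R by rewrite ltr0n.
pose t k : R := k%:R / n%:R.
have t01 k : (k <= n)%N -> `[0, 1]%classic (t k).
  move=> kn; rewrite /= in_itv /= divr_ge0 ?ler0n//=.
  by rewrite ler_pdivrMr// mul1r ler_nat.
have tS k : t k.+1 = t k + n%:R^-1 by rewrite /t -addn1 natrD mulrDl mul1r.
have tSlt k : t k < t k.+1 by rewrite tS ltrDl invr_gt0.
have t0 : t 0%N = 0 by rewrite /t mul0r.
have t_ge0 k : 0 <= t k by rewrite divr_ge0 ?ler0n.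
have osc k s : (k < n)%N -> t k <= s <= t k.+1 ->
    [/\ `[0, 1]%classic s, close_paths sg (fun x => f (x, t k)) (fun x => f (x, s)) &
        close_paths sg (fun x => g (x, t k)) (fun x => g (x, s))].
  move=> kn /andP[s1 s2].
  have s01 : `[0, 1]%classic s.
    have := t01 _ (ltnW kn); have := t01 _ kn; rewrite /= !in_itv /=; lra.
  have tks : `|t k - s| < Num.min d1 d2.
    by rewrite distrC ger0_norm ?subr_ge0//; move: s2; rewrite tS; lra.
  have sk x : `[0, 1]%classic x -> square (x, t k) by move=> x01; split => //; exact/t01/ltnW.
  have ss x : `[0, 1]%classic x -> square (x, s) by [].
  move: tks; rewrite lt_min => /andP[k1 k2]; split => // x x01.
    have : ball (x, t k) d1 (x, s) by split => //; exact: ballxx.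
    by move=> /(Hd1 _ _ (sk _ x01) (ss _ x01)); rewrite ballEmdist.
  have : ball (x, t k) d2 (x, s) by split => //; exact: ballxx.
  by move=> /(Hd2 _ _ (sk _ x01) (ss _ x01)); rewrite ballEmdist.
have [i0 i1] := (itv01_0, itv01_1).
(* The path for f reaches its new slice up to sg / 2 and loses at most sg / 2 while the other one
   moves, so the bound sg is restored at the end. *)
have block k a b : (k < n)%N ->
    {within `[0, 1]%classic, continuous a} -> {within `[0, 1]%classic, continuous b} ->
    disjoint_paths a b ->
    close_paths sg (fun x => f (x, t k)) a -> close_paths sg (fun x => g (x, t k)) b ->
    exists a' b',
    [/\ close_paths sg (fun x => f (x, t k.+1)) a',
        close_paths sg (fun x => g (x, t k.+1)) b' &
        track (eps / 2) (fun x => f (x, t k)) (fun x => g (x, t k)) a b a' b'].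
  move=> kn ca cb ab fa gb.
  have sg20 : 0 < sg / 2 by rewrite divr_gt0.
  have [|_ ofk ogk] := osc k (t k.+1) kn; first by rewrite lexx ltW.
  have [||u [cu u0 u1 fu]] := Hf (t k) a (fun x => f (x, t k.+1)) (t01 _ (ltnW kn)) ca
    (path_homotopy_slice cf (t01 _ kn)).
  - by apply: close_le fa; lra.
  - by apply: close_le ofk; lra.
  have [||a1 [b1 [[ca1 cb1] ab1 ua1 bb1 T1]]] :=
    @move_first (eps / 2) (sg / 2) (fun x => f (x, t k)) (fun x => g (x, t k)) a b u X_lc X_FMP e20 sg20 cb cu u0 ab.
  - by move=> s s01 x x01; exact: (fu (x, s)).
  - by apply: close_le gb; lra.
  have fa1 : close_paths (sg / 2) (fun x => f (x, t k.+1)) a1.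
    by move=> x x01; rewrite -u1//; exact: ua1.
  have gb1 := close_trans gb bb1.
  have [||v [cv v0 v1 gv]] := Hg (t k) b1 (fun x => g (x, t k.+1)) (t01 _ (ltnW kn)) cb1
    (path_homotopy_slice cg (t01 _ kn)).
  - by apply: close_le gb1; lra.
  - by apply: close_le ogk; lra.
  have ba1 : disjoint_paths b1 a1 by move=> x y x01 y01 /esym; exact: ab1.
  have [||b2 [a2 [_ _ vb2 aa2 T2]]] :=
    @move_first (eps / 2) (sg / 2) (fun x => g (x, t k)) (fun x => f (x, t k)) b1 a1 v X_lc X_FMP e20 sg20 ca1 cv v0 ba1.
  - by move=> s s01 x x01; exact: (gv (x, s)).
  - by apply: close_le (close_trans ofk fa1); lra.
  exists a2, b2; split.
  - by rewrite [sg]splitr; exact: close_trans fa1 aa2.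
  - move=> x x01; rewrite -v1//; apply: lt_le_trans (vb2 _ x01) _.
    by rewrite ler_pdivrMr// ler_pMr// ler1n.
  - exact: track_trans T1 (track_sym T2).
have chain k : (k <= n)%N -> exists F G : R * R -> X,
    [/\ {within `[0, 1]%classic `*` `[0, t k]%classic, continuous F} /\
        {within `[0, 1]%classic `*` `[0, t k]%classic, continuous G},
        forall s, 0 <= s <= t k ->
          close_paths eps (fun x => f (x, s)) (fun x => F (x, s)) /\
          close_paths eps (fun x => g (x, s)) (fun x => G (x, s)),
        forall s, 0 <= s <= t k ->
          disjoint_paths (fun x => F (x, s)) (fun x => G (x, s)),
        close_paths sg (fun x => f (x, t k)) (fun x => F (x, t k)) &
        close_paths sg (fun x => g (x, t k)) (fun x => G (x, t k))].
  elim: k => [|k IH] kn.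
    (* The initial disjoint paths come from the constant homotopies at the slices of time 0; only
       the time 0 slices of the result are kept. *)
    have [f' [g' [cf' cg' ff' gg' fg']]] := disjoint_from_constant X_FMP
      (const_path_homotopy (path_homotopy_slice cf i0)).1
      (const_path_homotopy (path_homotopy_slice cg i0)) sg0.
    have ca := path_homotopy_slice cf' i0; have cb := path_homotopy_slice cg' i0.
    have sx (s : R) : 0 <= s <= 0 -> s = 0 by lra.
    have ff0 : close_paths sg (fun x => f (x, 0)) (fun x => f' (x, 0)).
      by move=> x x01; exact: (ff' (x, 0)).
    have gg0 : close_paths sg (fun x => g (x, 0)) (fun x => g' (x, 0)).
      by move=> x x01; exact: (gg' (x, 0)).
    exists (fun z => f' (z.1, 0)), (fun z => g' (z.1, 0)); rewrite t0; split => //.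
    - split; [apply: (within_comp ca)|apply: (within_comp cb)]; try by move=> z [].
        by apply: within_fst; exact: within_id.
      by apply: within_fst; exact: within_id.
    - move=> s /sx->; split; first by apply: close_le ff0; lra.
      by apply: close_le gg0; lra.
    - by move=> s _ x y x01 y01; exact: fg'.
  have [F [G [[cF cG] Fe FG Fk Gk]]] := IH (ltnW kn).
  have tkk : 0 <= t k <= t k by rewrite t_ge0 lexx.
  have slice (H : R * R -> X) :
      {within `[0, 1]%classic `*` `[0, t k]%classic, continuous H} ->
      {within `[0, 1]%classic, continuous (fun x => H (x, t k))}.
    move=> cH; apply: (within_comp cH) => [|x x01]; last by split => //=; rewrite in_itv.
    by apply: within_pair; [exact: within_id|exact: within_cst].
  have [a' [b' [fa' gb' [F' [G' [[cF' cG'] F'e G'e F'c F'G']]]]]] :=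
    block k _ _ kn (slice F cF) (slice G cG) (FG _ tkk) Fk Gk.
  pose w v := (v - t k) / (t k.+1 - t k).
  have w0 : w (t k) = 0 by rewrite /w subrr mul0r.
  have w1 : w (t k.+1) = 1 by rewrite /w mulfV// gt_eqF// subr_gt0.
  pose j (u v : R * R -> X) (z : R * R) := if z.2 <= t k then u z else v (z.1, w z.2).
  have cj (u v : R * R -> X) : {within `[0, 1]%classic `*` `[0, t k]%classic, continuous u} ->
      path_homotopy v -> (forall x, `[0, 1]%classic x -> u (x, t k) = v (x, 0)) ->
      {within `[0, 1]%classic `*` `[0, t k.+1]%classic, continuous (j u v)}.
    move=> cu cv uv; apply: glue_t => //; first exact: ltW.
    - apply: (within_comp cv); last first.
        move=> [x s] [/= x01]; rewrite in_itv /= => sk; split => //=.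
        exact: itv01_affine.
      apply: within_pair; first by apply: within_fst; exact: within_id.
      apply: within_mul; last exact: within_cst.
      by apply: within_add; [apply: within_snd; exact: within_id|exact: within_cst].
    - by move=> x x01; rewrite /= w0 uv.
  have j1 u v x : j u v (x, t k.+1) = v (x, 1) by rewrite /j /= leNgt tSlt w1.
  have jt s : 0 <= s <= t k.+1 ->
      (0 <= s <= t k /\ forall u v x, j u v (x, s) = u (x, s)) \/
      [/\ t k <= s <= t k.+1, `[0, 1]%classic (w s) & forall u v x, j u v (x, s) = v (x, w s)].
    move=> /andP[s0 s1]; case: (lerP s (t k)) => sk; [left|right].
      by rewrite s0; split => // u v x; rewrite /j /= sk.
    have sI : t k <= s <= t k.+1 by rewrite s1 ltW.
    by split => //; [exact: itv01_affine|move=> u v x; rewrite /j /= leNgt sk].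
  exists (j F F'), (j G G'); split.
  - split; apply: cj => // x x01; first by rewrite (F'e _ x01).1.
    by rewrite (G'e _ x01).1.
  - move=> s /jt[[sk E]|[sk ws E]].
      by have [Fs Gs] := Fe _ sk; split => x x01; rewrite E; [exact: Fs|exact: Gs].
    have [_ osf osg] := osc _ _ kn sk; have [Fs Gs] := F'c _ ws.
    (* [sg] pays for the oscillation of f or g over the block, eps / 2 for the distance of the track
       from the slice at [t k]. *)
    have se : sg + eps / 2 <= eps by lra.
    split => x x01; rewrite E; apply: lt_le_trans se;
        apply: le_lt_trans (metric_triangle _ (_ (x, t k)) _) _; apply: ltrD.
    + by rewrite metric_sym; exact: osf.
    + exact: Fs.
    + by rewrite metric_sym; exact: osg.
    + exact: Gs.
  - move=> s /jt[[sk E]|[sk ws E]] x y x01 y01; rewrite !E; first exact: FG.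
    exact: F'G'.
  - by move=> x x01; rewrite j1 (F'e _ x01).2; exact: fa'.
  - by move=> x x01; rewrite j1 (G'e _ x01).2; exact: gb'.
have tn : t n = 1 by rewrite /t mulfV// gt_eqF.
have [F [G [[cF cG] Fe FG _ _]]] := chain _ (leqnn n).
rewrite tn in cF cG Fe FG.
exists F, G; split => //.
- by move=> [x s] [/= x01]; rewrite in_itv /= => s01; exact: (Fe _ s01).1.
- by move=> [x s] [/= x01]; rewrite in_itv /= => s01; exact: (Fe _ s01).2.
- move=> s; rewrite in_itv /= => s01; rewrite -subset0 => z [[x x01 <-] [y y01 /esym]].
  exact: (FG _ s01).
Qed.

End Tracks.

Theorem theorem3p11 (R : realType) (X : metricType R)
    (X_finite_dim : finite_dimensional X) (X_ANR : ANR X)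
    (X_FMP : delta_FMP X) : DHP X.
Proof. by apply: locally_contractible_FMP_DHP => //; case: X_ANR. Qed.
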